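(* In the linear regression setting of the context, define the two-step empirical Bayes estimate: (Step 1) $\hat\omega^{(0)}_b=1/(p+1)$ for $b=1,\ldots,B$, so that $\kappa^{(0)}_b=\log p+\tfrac12\log(1+gn)$; (Step 2) $\hat\omega^{(1)}_b=\frac1{p_b}\sum_{j:z_j=b}\pi(\gamma_j=1\mid\bm{y},\hat{\bm{\omega}}^{(0)})$, with $\kappa^{(1)}_b=\log(1/\hat\omega^{(1)}_b-1)+\tfrac12\log(1+gn)$. Suppose: (A1) $B$ is constant; (A4) $\sum_{b=1}^B s_b=o(\sqrt{1+gn})$; (A5) for each block $b$ there exists $a_b\to\infty$ such that for all sufficiently large $n$, $$\sqrt{\frac{(1-\psi)n\phi^{-1}\rho(\bm{X})}{6}}\,\theta^*_{\min,b}-\sqrt{\log\Big(\frac{p_b}{|S^L_b(\kappa^{(0)})|}-1\Big)+\tfrac12\log(1+gn)}=\sqrt{\log(s_b)}+a_b,$$ where $\psi=\tfrac12\Big(1+\max_b\frac{\log(p_b-s_b)}{\log(p_b/s_b-1)+\log(1+gn)/2}\Big)$; (A6) for each block $b$, $|S^I_b(\kappa^{(0)})|=O(1)$ and $|S^S_b(\kappa^{(0)})|=O(p_b-s_b)$. Then $\lim_{n\to\infty}E\big[\pi(\bm{\gamma}^*\mid\bm{y},\hat{\bm{\omega}}^{(1)})\big]=1$, the expectation being over $\bm{y}\sim N(\bm{X}\bm{\theta}^*,\phi I_n)$.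
   Context: Data: $\bm{y}\in\mathbb{R}^n$, fixed design $\bm{X}\in\mathbb{R}^{n\times p}$ ($p$ may grow with $n$), $\bm{y}\sim N(\bm{X}\bm{\theta}^*,\phi I_n)$ with known $\phi>0$. Each covariate $j$ has a block label $z_j\in\{1,\ldots,B\}$. Models $\bm{\gamma}\in\{0,1\}^p$ (identified with index sets); true model $\gamma^*_j=\mathrm{I}(\theta^*_j\ne0)$. Only models with $\bm{X}_{\bm{\gamma}}$ of full column rank are considered, and $\bm{\gamma}^*$ is among them. For $\bm{\omega}\in(0,1)^B$: model prior $\pi(\bm{\gamma}\mid\bm{\omega})=\prod_j\mathrm{Bern}(\gamma_j;\omega_{z_j})$; Zellner prior $\bm{\theta}_{\bm{\gamma}}\mid\bm{\gamma}\sim N(\mathbf0,g\phi(\bm{X}_{\bm{\gamma}}^T\bm{X}_{\bm{\gamma}}/n)^{-1})$, $g>0$ given. Posterior: $\pi(\bm{\gamma}\mid\bm{y},\bm{\omega})\propto\exp\{gn\hat{\bm{\theta}}_{\bm{\gamma}}^T\bm{X}_{\bm{\gamma}}^T\bm{X}_{\bm{\gamma}}\hat{\bm{\theta}}_{\bm{\gamma}}/(2\phi(1+gn))\}\prod_b\big(\omega_b/((1+gn)^{1/2}(1-\omega_b))\big)^{p_{\bm{\gamma},b}}$ with $\hat{\bm{\theta}}_{\bm{\gamma}}$ the least squares estimate, and $\pi(\gamma_j=1\mid\bm{y},\bm{\omega})=\sum_{\bm{\gamma}:\gamma_j=1}\pi(\bm{\gamma}\mid\bm{y},\bm{\omega})$.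 Notation: $p_b=\#\{j:z_j=b\}$, $p_{\bm{\gamma},b}=\#\{j\in\bm{\gamma}:z_j=b\}$, $s_b=\#\{j\in\bm{\gamma}^*:z_j=b\}$, $\theta^*_{\min,b}=\min\{|\theta^*_j|:z_j=b,\theta^*_j\ne0\}$; $\bm{P}_{\bm{\gamma}}$ the projection onto the column span of $\bm{X}_{\bm{\gamma}}$; $\rho(\bm{X})=\min_{\bm{\gamma}\not\supseteq\bm{\gamma}^*}\lambda_{\min}(\tfrac1n\bm{X}_{\bm{\gamma}^*\setminus\bm{\gamma}}^T(I-\bm{P}_{\bm{\gamma}})\bm{X}_{\bm{\gamma}^*\setminus\bm{\gamma}})$; $\bar\lambda=\lambda_{\max}(\tfrac1n\bm{X}_{\bm{\gamma}^*}^T\bm{X}_{\bm{\gamma}^*})$. For penalties $\kappa=(\kappa_1,\ldots,\kappa_B)$ let $\nu(\kappa)=\tfrac12(1+\max_b\log(p_b-s_b)/\kappa_b)$ and define the small, large and intermediate signal sets of block $b$: $S^S_b(\kappa)=\{j:z_j=b,\theta^*_j\ne0,\ \sqrt{n\bar\lambda}\,|\theta^*_j|/\sqrt\phi=o(\sqrt{\kappa_b})\}$; $S^L_b(\kappa)=\{j:z_j=b,\theta^*_j\ne0,\ \sqrt{(1-\nu(\kappa))n\rho(\bm{X})/(6\phi)}\,|\theta^*_j|-\sqrt{\kappa_b}-\sqrt{\log s_b}\to\infty\}$; $S^I_b(\kappa)=\{j:z_j=b\}\setminus(S^L_b(\kappa)\cup S^S_b(\kappa))$. All quantities may depend on $n$.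 *)

(* Defs.v *)
From HB Require Import structures.
From mathcomp Require Import all_boot all_order all_algebra.
From mathcomp Require Import all_classical all_reals all_analysis.
From mathcomp Require Import normal_distribution.
Set Implicit Arguments. Unset Strict Implicit. Unset Printing Implicit Defensive.
Import Order.TTheory GRing.Theory Num.Theory.
Import numFieldNormedType.Exports.
Local Open Scope classical_set_scope.
Local Open Scope ring_scope.

Section Defs.
Variable R : realType.

Definition subcols (n p : nat) (X : 'M[R]_(n, p)) (S : {set 'I_p}) : 'M[R]_(n, #|S|) :=
  colsub (fun k : 'I_#|S| => enum_val k) X.

Definition fullrank (n p : nat) (X : 'M[R]_(n, p)) (S : {set 'I_p}) : bool :=
  \rank (subcols X S) == #|S|.

(* projection onto the column span of X_S (for X_S of full column rank) *)
Definition projS (n p : nat) (X : 'M[R]_(n, p)) (S : {set 'I_p}) : 'M[R]_n :=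
  let XS := subcols X S in XS *m invmx (XS^T *m XS) *m XS^T.

Definition lse (n p : nat) (X : 'M[R]_(n, p)) (S : {set 'I_p}) (y : 'cV[R]_n)
  : 'cV[R]_#|S| :=
  let XS := subcols X S in invmx (XS^T *m XS) *m XS^T *m y.

Definition lambda_min (k : nat) (A : 'M[R]_k) : R := inf [set a | eigenvalue A a].
Definition lambda_max (k : nat) (A : 'M[R]_k) : R := sup [set a | eigenvalue A a].

Definition gstar (p : nat) (theta : 'cV[R]_p) : {set 'I_p} := [set j | theta j 0 != 0].

Definition pblk (p B : nat) (z : 'I_p -> 'I_B) (b : 'I_B) : nat := #|[set j | z j == b]|.

Definition pgam (p B : nat) (z : 'I_p -> 'I_B) (gam : {set 'I_p}) (b : 'I_B) : nat :=
  #|[set j in gam | z j == b]|.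

Definition sblk (p B : nat) (z : 'I_p -> 'I_B) (theta : 'cV[R]_p) (b : 'I_B) : nat :=
  pgam z (gstar theta) b.

Definition theta_min (p B : nat) (z : 'I_p -> 'I_B) (theta : 'cV[R]_p) (b : 'I_B) : R :=
  inf [set r | exists j, z j = b /\ theta j 0 != 0 /\ r = `|theta j 0|].

Definition rhoX (n p : nat) (X : 'M[R]_(n, p)) (gs : {set 'I_p}) : R :=
  inf [set r | exists gam : {set 'I_p}, fullrank X gam /\ ~~ (gs \subset gam) /\
        r = lambda_min ((n%:R)^-1 *:
              ((subcols X (gs :\: gam))^T *m (1%:M - projS X gam) *m subcols X (gs :\: gam)))].

Definition lambda_bar (n p : nat) (X : 'M[R]_(n, p)) (gs : {set 'I_p}) : R :=
  lambda_max ((n%:R)^-1 *: ((subcols X gs)^T *m subcols X gs)).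

Definition post_weight (n p B : nat) (X : 'M[R]_(n, p)) (z : 'I_p -> 'I_B) (phi g : R)
  (om : 'I_B -> R) (y : 'cV[R]_n) (gam : {set 'I_p}) : R :=
  let XS := subcols X gam in
  let th := lse X gam y in
  expR (g * n%:R * (th^T *m (XS^T *m XS) *m th) 0 0 / (2 * phi * (1 + g * n%:R))) *
  \prod_(b < B) (om b / (Num.sqrt (1 + g * n%:R) * (1 - om b))) ^+ pgam z gam b.

Definition posterior (n p B : nat) (X : 'M[R]_(n, p)) (z : 'I_p -> 'I_B) (phi g : R)
  (om : 'I_B -> R) (y : 'cV[R]_n) (gam : {set 'I_p}) : R :=
  if fullrank X gam then
    post_weight X z phi g om y gam /
      \sum_(gam' : {set 'I_p} | fullrank X gam') post_weight X z phi g om y gam'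
  else 0.

Definition incl_prob (n p B : nat) (X : 'M[R]_(n, p)) (z : 'I_p -> 'I_B) (phi g : R)
  (om : 'I_B -> R) (y : 'cV[R]_n) (j : 'I_p) : R :=
  \sum_(gam : {set 'I_p} | j \in gam) posterior X z phi g om y gam.

Definition omega0 (p B : nat) : 'I_B -> R := fun _ => (p%:R + 1)^-1.

Definition omega1 (n p B : nat) (X : 'M[R]_(n, p)) (z : 'I_p -> 'I_B) (phi g : R)
  (y : 'cV[R]_n) : 'I_B -> R :=
  fun b => (pblk z b)%:R^-1 *
           \sum_(j : 'I_p | z j == b) incl_prob X z phi g (@omega0 p B) y j.

Definition kappa0 (n p : nat) (g : R) : R := ln (p%:R) + ln (1 + g * n%:R) / 2.


Definition nu0 (n p B : nat) (z : 'I_p -> 'I_B) (theta : 'cV[R]_p) (g : R) : R :=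
  (1 + sup (range (fun b : 'I_B =>
          ln ((pblk z b - sblk z theta b)%:R) / kappa0 n p g))) / 2.

Definition psi (n p B : nat) (z : 'I_p -> 'I_B) (theta : 'cV[R]_p) (g : R) : R :=
  (1 + sup (range (fun b : 'I_B =>
          ln ((pblk z b - sblk z theta b)%:R) /
          (ln ((pblk z b)%:R / (sblk z theta b)%:R - 1) + ln (1 + g * n%:R) / 2)))) / 2.

Definition SIset (p B : nat) (z : 'I_p -> 'I_B) (SS SL : {set 'I_p}) (b : 'I_B)
  : {set 'I_p} :=
  [set j | z j == b] :\: (SL :|: SS).

(* gexp k F = E[F(e)] where e_0,...,e_{k-1} are i.i.d. N(0,1) and e_i = 0 for i >= k
   (iterated integral against the standard normal probability measure) *)
Fixpoint gexp (k : nat) (F : (nat -> R) -> R) : R :=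
  match k with
  | 0 => F (fun _ => 0)
  | k'.+1 => \int[normal_prob (0:R) 1]_x
               gexp k' (fun e => F (fun i => if i == k' then x else e i))
  end.

(* y = X theta + sqrt(phi) e  ~  N(X theta, phi I_n) *)
Definition ydraw (n p : nat) (X : 'M[R]_(n, p)) (theta : 'cV[R]_p) (phi : R)
  (e : nat -> R) : 'cV[R]_n :=
  X *m theta + Num.sqrt phi *: \col_(i < n) e i.

End Defs.

(* Main.v *)
Require Import Defs.
From HB Require Import structures.
From mathcomp Require Import all_boot all_order all_algebra.
From mathcomp Require Import all_classical all_reals all_analysis.
From mathcomp Require Import normal_distribution measurable_realfun.
From mathcomp Require Import ring lra.
Set Implicit Arguments. Unset Strict Implicit. Unset Printing Implicit Defensive.
Import Order.TTheory GRing.Theory Num.Theory.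
Import numFieldNormedType.Exports.
Local Open Scope classical_set_scope.
Local Open Scope ring_scope.

(** Two consequences of the hypotheses make the problem nearly finite. Since
    [S^I_b] contains every inactive covariate of block [b], (A6) bounds both
    [p_b - s_b] and the number of covariates outside [S^L_b]; and (A5) forces
    [s_b >= 1], so that with (A4) the factor [G = sqrt (1 + g n)] diverges and
    [p = o(G)]. Moreover [psi, nu >= 1/2], so every active signal satisfies
    [n rho theta_j^2 / phi >= 12 log G], and [>= 12 (kappa0 + log s_b)] on [S^L_b].

    Write [y = X theta + sqrt phi e]. For a model [gam] with residual mean
    [m = (1 - P_gam) X theta / sqrt phi], Gram-Schmidt on the inactive columns gives
    [|P_gam y|^2 - |P_gam* y|^2 <= phi (- |m|^2 - 2 m.e + sum_u (u.e)^2)] with a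
    bounded number of vectors [u] of norm at most 1. As a posterior probability is at
    most 1, it is at most the square root of the weight ratio, which on the event
    [|u.e| <= t] is a constant times [exp (- h |m|^2 / 4 - h m.e / 2)] times penalties.
    Thus [1 - pi(gam* | y)] is dominated by a finite combination of exponentials of
    linear forms in [e], whose Gaussian mean is explicit and factorizes over the
    covariates that [gam] gets wrong.

    Applied with [omega0], this shows that with high probability the inclusion
    probabilities differ from the truth by at most 1/2 in total, which pins the odds of
    [omega1_b] between [s_b / (2 (p_b - s_b + 1))] and, if [p_b > s_b], [3 s_b]. The
    same bound applied with [omega1] gives the result. *)

(** * Gaussian expectations *)

(* The integral of a nonnegative function is a supremum over simple functions
   below it, so monotonicity needs no measurability. *)
Lemma ge0_le_integral_nomeas (d : measure_display) (T : measurableType d)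
    (R : realType) (mu : {measure set T -> \bar R}) (f1 f2 : T -> \bar R) :
  (forall x, 0 <= f1 x)%E -> (forall x, f1 x <= f2 x)%E ->
  (\int[mu]_x f1 x <= \int[mu]_x f2 x)%E.
Proof.
move=> f10 f12; have f20 x : (0 <= f2 x)%E by exact: le_trans (f12 x).
rewrite !ge0_integralTE//; apply: le_ereal_sup => _ [h /= hf <-].
by exists h => //= x; exact: le_trans (f12 x).
Qed.

Lemma integral_le1_nomeas (d : measure_display) (T : measurableType d)
    (R : realType) (mu : probability T R) (f : T -> R) :
  (forall x, 0 <= f x <= 1) -> (\int[mu]_x (f x)%:E <= 1)%E.
Proof.
move=> f01; have -> : (1 = \int[mu]_x (cst 1 x))%E.
  by rewrite integral_cst//= mul1e probability_setT.
by apply: ge0_le_integral_nomeas => x; rewrite lee_fin; have /andP[] := f01 x.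
Qed.

Lemma Rintegral_itv01 (d : measure_display) (T : measurableType d)
    (R : realType) (mu : probability T R) (f : T -> R) :
  (forall x, 0 <= f x <= 1) -> 0 <= \int[mu]_x f x <= 1.
Proof.
move=> f01; have f0 x : 0 <= f x by have /andP[] := f01 x.
apply/andP; split; first by apply: Rintegral_ge0.
have le1 := integral_le1_nomeas mu f01.
have ge0 : (0 <= \int[mu]_x (f x)%:E)%E by apply: integral_ge0 => x _; rewrite lee_fin.
rewrite /Rintegral -lee_fin fineK//.
by rewrite ge0_fin_numE// (le_lt_trans le1)// ltry.
Qed.

(** In the application [f] is a partial Gaussian mean of a posterior probability, about which only
    bounds are known. The positive part of the integrable minorant [h] is compared with [f] through
    suprema over simple functions. *)
Lemma le_Rintegral_nomeas (d : measure_display) (T : measurableType d)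
    (R : realType) (mu : probability T R) (h f : T -> R) :
  mu.-integrable setT (EFin \o h) -> (forall x, 0 <= f x <= 1) ->
  (forall x, h x <= f x) -> \int[mu]_x h x <= \int[mu]_x f x.
Proof.
move=> ih f01 hf; have f0 x : 0 <= f x by have /andP[] := f01 x.
have ige0 : (0 <= \int[mu]_x (f x)%:E)%E by apply: integral_ge0 => x _; rewrite lee_fin.
have le1 := integral_le1_nomeas mu f01.
apply: fine_le.
- exact: integrable_fin_num.
- by rewrite ge0_fin_numE// (le_lt_trans le1)// ltry.
rewrite integralE; apply: (@le_trans _ _ (\int[mu]_x ((EFin \o h)^\+ x))%E).
  by rewrite leeBlDr ?leeDl ?integral_ge0//; exact: integrable_neg_fin_num.
apply: ge0_le_integral_nomeas => x; first exact: funepos_ge0.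
by rewrite funeposE /= ge_max !lee_fin f0 hf.
Qed.

(** The Radon-Nikodym derivative and [normal_pdf] have equal integrals over every measurable set,
    hence agree almost everywhere. *)
Lemma ge0_integral_normal_prob (R : realType) (m s : R) (f : R -> \bar R) :
  (forall x, 0 <= f x)%E -> measurable_fun setT f ->
  (\int[normal_prob m s]_x f x =
   \int[lebesgue_measure]_x (f x * (normal_pdf m s x)%:E))%E.
Proof.
move=> f0 mf.
rewrite -(Radon_Nikodym_SigmaFinite.change_of_variables (@normal_prob_dominates R m s))//.
have fi := Radon_Nikodym_SigmaFinite.f_integrable (@normal_prob_dominates R m s).
have mg : measurable_fun setT (fun x : R => (normal_pdf m s x)%:E).
  by apply/measurable_EFinP; exact: measurable_normal_pdf.
apply: ae_eq_integral => //.
- by apply: emeasurable_funM => //; exact: measurable_int fi.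
- exact: emeasurable_funM.
apply: ae_eqe_mul2l; apply: integral_ae_eq => // E _ mE.
by rewrite -(Radon_Nikodym_SigmaFinite.f_integral (@normal_prob_dominates R m s)).
Qed.

(** Completing the square: [exp (a x)] times the standard density is [exp (a^2 / 2)] times the
    normal density of mean [a]. *)
Lemma normal_mgf (R : realType) (a : R) :
  (\int[normal_prob (0:R) 1]_x (expR (a * x))%:E = (expR (a ^+ 2 / 2))%:E)%E.
Proof.
rewrite ge0_integral_normal_prob; last 2 first.
- by move=> x; rewrite lee_fin expR_ge0.
- apply/measurable_EFinP; apply: measurableT_comp => //.
transitivity (\int[lebesgue_measure]_x ((expR (a ^+ 2 / 2))%:E * (normal_pdf a 1 x)%:E))%E.
  apply: eq_integral => x _; rewrite -!EFinM; congr EFin.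
  rewrite !normal_pdfE ?oner_eq0// mulrCA [RHS]mulrCA /normal_fun -!expRD.
  by congr (_ * expR _); rewrite expr1n subr0; field.
rewrite ge0_integralZl ?lee_fin ?expR_ge0//; first by rewrite integral_normal_pdf mule1.
- by apply/measurable_EFinP; exact: measurable_normal_pdf.
- by move=> x _; rewrite lee_fin normal_pdf_ge0.
Qed.

Lemma integrable_expR_normal (R : realType) (a : R) :
  (normal_prob (0:R) 1).-integrable setT (EFin \o (fun x => expR (a * x))).
Proof.
apply/integrableP; split.
  apply/measurable_EFinP; apply: measurableT_comp => //.
under eq_integral do rewrite /= ger0_norm ?expR_ge0//.
by rewrite normal_mgf ltry.
Qed.

(* A term [(c, v)] of [l] stands for [c * exp (v . e)]; its Gaussian mean is
   [c * exp (|v|^2 / 2)]. *)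
Lemma gexp_ge_expsum (R : realType) (n : nat) (l : seq (R * (nat -> R)))
    (F : (nat -> R) -> R) :
  (forall e, 0 <= F e <= 1) ->
  (forall e : nat -> R, 1 - \sum_(cv <- l) cv.1 * expR (\sum_(i < n) cv.2 i * e i) <= F e) ->
  0 <= gexp n F <= 1 /\
  1 - \sum_(cv <- l) cv.1 * expR ((\sum_(i < n) cv.2 i ^+ 2) / 2) <= gexp n F.
Proof.
elim: n l F => [|n IHn] l F F01 lF.
  split; first exact: F01.
  rewrite /=; apply: le_trans (lF (fun=> 0)); rewrite lerB//.
  by apply: ler_sum => cv _; rewrite !big_ord0 mul0r.
(* The outer integral fixes coordinate [n] at [x]; each term absorbs [exp (v_n x)] into its
   coefficient, so the induction ranges over all lists. The bounds 0 and 1 are carried along because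
   the next integrand must satisfy them. *)
pose Fx x := fun e : nat -> R => F (fun i => if i == n then x else e i).
pose lx x := [seq (cv.1 * expR (cv.2 n * x), cv.2) | cv : (R * (nat -> R)) <- l].
have IH x : 0 <= gexp n (Fx x) <= 1 /\
    1 - \sum_(cv <- lx x) cv.1 * expR ((\sum_(i < n) cv.2 i ^+ 2) / 2) <= gexp n (Fx x).
  apply: IHn => [e|e]; first exact: F01.
  apply: le_trans (lF _); rewrite lerB// big_map; apply: ler_sum => cv _ /=.
  rewrite big_ord_recr/= eqxx expRD (mulrC (expR _)) mulrA.
  rewrite (eq_bigr (fun i : 'I_n => cv.2 i * e i))// => i _.
  by rewrite ltn_eqF.
rewrite [gexp n.+1 F]/=.
have IH1 x : 0 <= gexp n (Fx x) <= 1 by have [] := IH x.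
split; first exact: Rintegral_itv01.
pose K (cv : R * (nat -> R)) := cv.1 * expR ((\sum_(i < n) cv.2 i ^+ 2) / 2).
pose h x := 1 - \sum_(cv <- l) K cv * expR (cv.2 n * x).
have iK cv : (normal_prob (0:R) 1).-integrable setT (EFin \o (fun x => K cv * expR (cv.2 n * x))).
  rewrite (_ : EFin \o _ = fun x => ((K cv)%:E * (expR (cv.2 n * x))%:E)%E)//.
  by apply: integrableZl => //; exact: integrable_expR_normal.
have isum : (normal_prob (0:R) 1).-integrable setT
    (EFin \o (fun x => \sum_(cv <- l) K cv * expR (cv.2 n * x))).
  rewrite (_ : EFin \o _ = fun x => (\sum_(cv <- l) (K cv * expR (cv.2 n * x))%:E)%E); last first.
    by apply/funext => x /=; rewrite sumEFin.
  by apply: integrable_sum => // cv _; exact: iK.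
have i1 : (normal_prob (0:R) 1).-integrable setT (EFin \o (fun _ : R => 1)).
  exact: finite_measure_integrable_cst.
apply: le_trans (@le_Rintegral_nomeas _ _ _ (normal_prob (0:R) 1) h _ _ IH1 _).
- rewrite RintegralB// Rintegral_cst// /= probability_setT/= mulr1 lerB//.
  rewrite /Rintegral; under eq_integral do rewrite -sumEFin.
  rewrite integral_sum//=.
  rewrite (eq_bigr (fun cv => (K cv * expR (cv.2 n ^+ 2 / 2))%:E)) => [|cv _].
    rewrite sumEFin/=; apply: ler_sum => cv _.
    by rewrite /K -mulrA -expRD big_ord_recr/= mulrDl.
  under eq_integral do rewrite EFinM.
  by rewrite integralZl ?normal_mgf ?EFinM//; exact: integrable_expR_normal.
- rewrite (_ : EFin \o h = (fun x => (EFin \o (fun _ : R => 1%R)) x - (EFin \o (fun x => \sum_(cv <- l) K cv * expR (cv.2 n * x))%R) x)%E)//.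
  exact: integrableB.
- move=> x; have [_] := IH x; apply: le_trans; rewrite big_map /= /h lerB//.
  apply: ler_sum => cv _ /=; rewrite /K le_eqVlt; apply/orP; left; apply/eqP.
  by rewrite mulrAC.
Qed.

(** * Quadratic forms and orthogonal projections *)

Section LinearAlgebra.
Variable R : realType.

Definition dot (n : nat) (u v : 'cV[R]_n) : R := (u^T *m v) 0 0.
Definition nsq (n : nat) (u : 'cV[R]_n) : R := dot u u.

Lemma dotE n (u v : 'cV[R]_n) : dot u v = \sum_i u i 0 * v i 0.
Proof. by rewrite /dot mxE; apply: eq_bigr => i _; rewrite mxE. Qed.

Lemma dotC n (u v : 'cV[R]_n) : dot u v = dot v u.
Proof. by rewrite !dotE; apply: eq_bigr => i _; rewrite mulrC. Qed.

Lemma dotDr n (u v w : 'cV[R]_n) : dot u (v + w) = dot u v + dot u w.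
Proof. by rewrite /dot mulmxDr mxE. Qed.

Lemma dotZr n (a : R) (u v : 'cV[R]_n) : dot u (a *: v) = a * dot u v.
Proof. by rewrite /dot -scalemxAr mxE. Qed.

Lemma dotDl n (u v w : 'cV[R]_n) : dot (u + v) w = dot u w + dot v w.
Proof. by rewrite dotC dotDr !(dotC w). Qed.

Lemma dotZl n (a : R) (u v : 'cV[R]_n) : dot (a *: u) v = a * dot u v.
Proof. by rewrite dotC dotZr dotC. Qed.

Lemma dotNr n (u v : 'cV[R]_n) : dot u (- v) = - dot u v.
Proof. by rewrite -scaleN1r dotZr mulN1r. Qed.

Lemma dotBr n (u v w : 'cV[R]_n) : dot u (v - w) = dot u v - dot u w.
Proof. by rewrite dotDr dotNr. Qed.

Lemma dot0r n (u : 'cV[R]_n) : dot u 0 = 0.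
Proof. by rewrite /dot mulmx0 mxE. Qed.

Lemma dot_sumr n (I : Type) (r : seq I) (u : 'cV[R]_n) (F : I -> 'cV[R]_n) :
  dot u (\sum_(i <- r) F i) = \sum_(i <- r) dot u (F i).
Proof. by elim/big_rec2: _ => [|i y x _ <-]; rewrite ?dot0r ?dotDr. Qed.

Lemma dot_mull m n (A : 'M[R]_(m, n)) (u : 'cV[R]_n) (v : 'cV[R]_m) :
  dot (A *m u) v = dot u (A^T *m v).
Proof. by rewrite /dot trmx_mul mulmxA. Qed.

Lemma nsqE n (u : 'cV[R]_n) : nsq u = \sum_i u i 0 ^+ 2.
Proof. by rewrite /nsq dotE. Qed.

Lemma nsq_ge0 n (u : 'cV[R]_n) : 0 <= nsq u.
Proof. by rewrite nsqE; apply: sumr_ge0 => i _; rewrite sqr_ge0. Qed.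

Lemma nsq_eq0 n (u : 'cV[R]_n) : nsq u = 0 -> u = 0.
Proof.
move/eqP; rewrite nsqE psumr_eq0; last by move=> i _; rewrite sqr_ge0.
move=> /allP u0; apply/colP => i; rewrite mxE; apply/eqP.
by have := u0 i (mem_index_enum i); rewrite sqrf_eq0.
Qed.

Lemma nsqD n (u v : 'cV[R]_n) : nsq (u + v) = nsq u + 2 * dot u v + nsq v.
Proof. by rewrite /nsq !dotDl !dotDr (dotC v u); ring. Qed.

Lemma nsqZ n (a : R) (u : 'cV[R]_n) : nsq (a *: u) = a ^+ 2 * nsq u.
Proof. by rewrite /nsq dotZl dotZr mulrA expr2. Qed.

Lemma coord_le_nsq n (u : 'cV[R]_n) i : u i 0 ^+ 2 <= nsq u.
Proof.
rewrite nsqE (bigD1 i)//= lerDl; apply: sumr_ge0 => j _; exact: sqr_ge0.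
Qed.

(** From [2 |v_i v_j| <= v_i^2 + v_j^2 <= 2 |v|^2]; the added 1 keeps [K] positive for the zero
    matrix. *)
Lemma quad_form_bound n (A : 'M[R]_n) :
  exists2 K, 0 < K & forall v : 'cV[R]_n, `|dot v (A *m v)| <= K * nsq v.
Proof.
exists (1 + \sum_i \sum_j `|A i j|) => [|v].
  by rewrite ltr_pwDl//; do 2 (apply: sumr_ge0 => ? _).
apply: (@le_trans _ _ ((\sum_i \sum_j `|A i j|) * nsq v)); last first.
  by rewrite ler_wpM2r ?nsq_ge0// lerDr.
rewrite dotE mulr_suml; apply: le_trans (ler_norm_sum _ _ _) _.
apply: ler_sum => i _; rewrite mxE mulr_sumr mulr_suml.
apply: le_trans (ler_norm_sum _ _ _) _; apply: ler_sum => j _.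
rewrite mulrCA normrM ler_wpM2l// normrM.
have := coord_le_nsq v i; have := coord_le_nsq v j.
rewrite -(real_normK (num_real (v i 0))) -(real_normK (num_real (v j 0))).
have := sqr_ge0 (`|v i 0| - `|v j 0|).
by nra.
Qed.

(* If the infimum [c] of the Rayleigh quotient were not an eigenvalue, the
   positive form of [A - c] would be bounded below by that of its (bounded)
   inverse, and [c] could be increased. *)
Lemma lambda_min_rayleigh n (A : 'M[R]_n) (v : 'cV[R]_n) :
  A^T = A -> lambda_min A * nsq v <= dot v (A *m v).
Proof.
move=> Asym; have [/nsq_eq0 ->|v0] := eqVneq (nsq v) 0.
  by rewrite /nsq mulmx0 dot0r mulr0.
pose ray := [set r | exists w : 'cV[R]_n, nsq w != 0 /\ r = dot w (A *m w) / nsq w].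
have [K K0 AK] := quad_form_bound A.
have rayv : ray (dot v (A *m v) / nsq v) by exists v.
have raylb : has_lbound ray.
  exists (- K) => _ [w [w0 ->]].
  have wp : 0 < nsq w by rewrite lt_neqAle eq_sym w0 nsq_ge0.
  rewrite ler_pdivlMr// mulNr; have := AK w; rewrite ler_norml => /andP[]//.
pose c := inf ray.
have cP w : c * nsq w <= dot w (A *m w).
  have [/nsq_eq0 ->|w0] := eqVneq (nsq w) 0.
    by rewrite /nsq mulmx0 dot0r mulr0.
  have wp : 0 < nsq w by rewrite lt_neqAle eq_sym w0 nsq_ge0.
  by rewrite -ler_pdivlMr//; apply: ge_inf => //; exists w.
pose M := A - c%:M.
have Msym : M^T = M by rewrite /M linearB/= Asym tr_scalar_mx.
have ME w : dot w (M *m w) = dot w (A *m w) - c * nsq w.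
  by rewrite /M mulmxBl dotBr mul_scalar_mx dotZr.
have Mpos w : 0 <= dot w (M *m w) by rewrite ME subr_ge0 cP.
have ceig : eigenvalue A c.
  case: (boolP (eigenvalue A c)) => // neig; exfalso.
  have Munit : M \in unitmx.
    rewrite -row_free_unit -kermx_eq0.
    by move: neig; rewrite /eigenvalue /eigenspace negbK.
  have [K1 K10 MK1] := quad_form_bound M.
  have [K2 K20 NK2] := quad_form_bound ((invmx M)^T *m invmx M).
  (* This is positivity of the form of [M] at [w - M w / K1], the form at [M w] being at most
     [K1 |M w|^2]. *)
  have step1 w : nsq (M *m w) <= K1 * dot w (M *m w).
    have := Mpos (w + (- K1^-1) *: (M *m w)).
    rewrite mulmxDr -scalemxAr dotDl !dotDr !dotZl !dotZr.
    have -> : dot w (M *m (M *m w)) = nsq (M *m w).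
      by rewrite /nsq dot_mull Msym.
    have := MK1 (M *m w); rewrite ler_norml => /andP[_].
    have K1i : K1 * K1^-1 = 1 by rewrite mulfV// gt_eqF.
    rewrite -/(nsq (M *m w)).
    move: (nsq _) (dot w _) (dot (M *m w) _) => N f g hg hf.
    have : 0 <= K1 * (f + - K1^-1 * N + (- K1^-1 * N + - K1^-1 * (- K1^-1 * g))).
      by rewrite mulr_ge0// ltW.
    have -> : K1 * (f + - K1^-1 * N + (- K1^-1 * N + - K1^-1 * (- K1^-1 * g))) =
      K1 * f - 2 * ((K1 * K1^-1) * N) + (K1 * K1^-1) * (K1^-1 * g) by ring.
    rewrite K1i !mul1r.
    have : K1^-1 * g <= N by rewrite mulrC ler_pdivrMr// mulrC.
    by lra.
  have step2 w : nsq w <= K2 * nsq (M *m w).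
    have {1}-> : w = invmx M *m (M *m w) by rewrite mulKmx.
    rewrite {1}/nsq dot_mull mulmxA.
    by have := NK2 (M *m w); rewrite ler_norml => /andP[_].
  have : c + (K2 * K1)^-1 <= c.
    apply: lb_le_inf; first by exists (dot v (A *m v) / nsq v).
    move=> _ [w [w0 ->]].
    have wp : 0 < nsq w by rewrite lt_neqAle eq_sym w0 nsq_ge0.
    rewrite ler_pdivlMr// mulrDl -lerBrDl -ME.
    rewrite mulrC ler_pdivrMr ?mulr_gt0//.
    apply: le_trans (step2 w) _; rewrite [leRHS]mulrC -mulrA; exact: ler_wpM2l (ltW K20) _ _ (step1 w).
  by apply/negP; rewrite -ltNge ltrDl invr_gt0 mulr_gt0.
(* As [c] is an eigenvalue, [lambda_min A <= c] once the spectrum is bounded below; [c] itself is a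
   bound, tested on transposed left eigenvectors. *)
apply: le_trans (cP v); rewrite ler_wpM2r ?nsq_ge0//; apply: ge_inf => //.
exists c => a /eigenvalueP[w wA w0].
have wt0 : 0 < nsq w^T.
  rewrite lt_neqAle nsq_ge0 andbT eq_sym; apply/eqP => /nsq_eq0/(congr1 trmx).
  by rewrite trmxK trmx0 => /eqP; rewrite (negPf w0).
have := cP w^T; rewrite -{1}Asym -trmx_mul wA linearZ/= dotZr.
by rewrite ler_pM2r.
Qed.

Definition oproj n (P : 'M[R]_n) := P^T = P /\ P *m P = P.

Lemma oproj_dot n (P : 'M[R]_n) (u : 'cV[R]_n) :
  oproj P -> dot u (P *m u) = nsq (P *m u).
Proof. by move=> [PT PP]; rewrite /nsq dot_mull PT mulmxA PP. Qed.

Lemma oproj_compl n (P : 'M[R]_n) : oproj P -> oproj (1%:M - P).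
Proof.
move=> [PT PP]; split; first by rewrite linearB/= PT trmx1.
by rewrite mulmxBl mul1mx mulmxBr mulmx1 PP subrr subr0.
Qed.

Lemma nsq_compl n (P : 'M[R]_n) (u : 'cV[R]_n) :
  oproj P -> nsq ((1%:M - P) *m u) = nsq u - dot u (P *m u).
Proof.
by move=> oP; rewrite -oproj_dot ?mulmxBl ?mul1mx ?dotBr//; exact: oproj_compl.
Qed.

(** Transposing [V P = P] gives [P V = P], so [P u] is the projection of [V u] and cannot be
    longer. *)
Lemma oproj_le n (P V : 'M[R]_n) (u : 'cV[R]_n) :
  oproj P -> oproj V -> V *m P = P -> dot u (P *m u) <= dot u (V *m u).
Proof.
move=> oP oV VP; have PV : P *m V = P.
  by case: (oP) (oV) => PT _ [VT _]; rewrite -[LHS]trmxK trmx_mul PT VT VP.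
rewrite (oproj_dot u oV) (oproj_dot u oP) -PV -mulmxA -(oproj_dot (V *m u) oP).
by have := nsq_ge0 ((1%:M - P) *m (V *m u)); rewrite nsq_compl// subr_ge0.
Qed.

(* Gram-Schmidt; a vector already in the range contributes [u = 0], since
   [_ / 0 = 0]. *)
Lemma oproj_extend n (s : seq 'cV[R]_n) (P : 'M[R]_n) : oproj P ->
  exists us : seq 'cV[R]_n, [/\ size us = size s, {in us, forall u, nsq u <= 1},
    oproj (P + \sum_(u <- us) u *m u^T),
    (P + \sum_(u <- us) u *m u^T) *m P = P &
    {in s, forall x, (P + \sum_(u <- us) u *m u^T) *m x = x}].
Proof.
elim: s P => [|x s IHs] P oP.
  by exists [::]; split => //; rewrite big_nil addr0//; case: oP.
have [PT PP] := oP.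
pose r := (1%:M - P) *m x; pose u := (Num.sqrt (nsq r))^-1 *: r.
have Pr : P *m r = 0 by rewrite /r mulmxA mulmxBr mulmx1 PP subrr mul0mx.
have Pu : P *m u = 0 by rewrite /u -scalemxAr Pr scaler0.
have uP : u^T *m P = 0 by rewrite -[P]PT -trmx_mul Pu trmx0.
(* Both cases at once: [u] is a unit vector or 0, and either satisfies this identity. *)
have nu : nsq u *: (u *m u^T) = u *m u^T /\ nsq u <= 1.
  rewrite /u nsqZ exprVn sqr_sqrtr ?nsq_ge0//.
  have [/nsq_eq0 ->|r0] := eqVneq (nsq r) 0.
    by rewrite scaler0 mul0mx scaler0 /nsq dot0r mulr0 ler01.
  by rewrite mulVf// scale1r lexx.
have uu : u *m u^T *m (u *m u^T) = u *m u^T.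
  rewrite -mulmxA (mulmxA u^T) [u^T *m u]mx11_scalar -/(dot u u) mul_scalar_mx -scalemxAr.
  by case: nu.
pose P1 := P + u *m u^T.
have oP1 : oproj P1.
  split; first by rewrite /P1 linearD/= PT trmx_mul trmxK.
  by rewrite /P1 mulmxDl !mulmxDr PP uu mulmxA Pu mul0mx addr0 -mulmxA uP mulmx0 add0r.
have P1x : P1 *m x = x.
  have ux : dot u x = Num.sqrt (nsq r).
    have -> : dot u x = dot u r.
      by rewrite /r mulmxBl mul1mx dotBr -[P in X in _ - X]PT -dot_mull Pu (dotC 0) dot0r subr0.
    rewrite /u dotZl -/(nsq r); have [->|r0] := eqVneq (nsq r) 0.
      by rewrite sqrtr0 mulr0.
    by rewrite -{2}[nsq r]sqr_sqrtr ?nsq_ge0// expr2 mulKf// sqrtr_eq0 -ltNge lt_neqAle eq_sym r0 nsq_ge0.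
  rewrite /P1 mulmxDl -mulmxA [u^T *m x]mx11_scalar -/(dot u x) ux mul_mx_scalar /u scalerA.
  have [r0|r0] := eqVneq (nsq r) 0.
    rewrite (nsq_eq0 r0) scaler0 addr0; apply/esym/eqP; rewrite -subr_eq0.
    by rewrite -{1}(mul1mx x) -mulmxBl -/r (nsq_eq0 r0).
  rewrite mulfV ?scale1r; last by rewrite sqrtr_eq0 -ltNge lt_neqAle eq_sym r0 nsq_ge0.
  by rewrite /r mulmxBl mul1mx addrC subrK.
have [us [sz nus oV VP Vs]] := IHs P1 oP1.
exists (u :: us); rewrite big_cons addrA -/P1.
split => //=; first by rewrite sz.
- by move=> w; rewrite inE => /orP[/eqP ->|/nus//]; case: nu.
- have P1P : P1 *m P = P by rewrite /P1 mulmxDl PP -mulmxA uP mulmx0 addr0.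
  by rewrite -{1}P1P mulmxA VP.
- move=> w; rewrite inE => /orP[/eqP ->|/Vs//].
  by rewrite -{1}P1x mulmxA VP.
Qed.

End LinearAlgebra.

(** * Least squares projections *)

Section Design.
Variables (R : realType) (n p : nat) (X : 'M[R]_(n, p)).
Implicit Types (S gam : {set 'I_p}) (y e : 'cV[R]_n).

Lemma subcols_delta S (k : 'I_#|S|) :
  subcols X S *m delta_mx k 0 = col (enum_val k) X.
Proof. by rewrite -colE; apply/colP => i; rewrite !mxE. Qed.

Lemma mulmx_cols (th : 'cV[R]_p) : X *m th = \sum_j th j 0 *: col j X.
Proof.
apply/colP => i; rewrite mxE summxE; apply: eq_bigr => j _.
by rewrite !mxE mulrC.
Qed.

Lemma subcols_mul S (th : 'cV[R]_p) :
  subcols X S *m (\col_k th (enum_val k) 0) = \sum_(j in S) th j 0 *: col j X.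
Proof.
apply/colP => i; rewrite mxE summxE [RHS]big_enum_val; apply: eq_bigr => j _.
by rewrite !mxE mulrC.
Qed.

Lemma gram_unit S : fullrank X S -> (subcols X S)^T *m subcols X S \in unitmx.
Proof.
move=> /eqP fr; rewrite -row_free_unit; apply: inj_row_free => w w0.
have XSw : subcols X S *m w^T = 0.
  apply: nsq_eq0; rewrite /nsq /dot trmx_mul trmxK -mulmxA mulmxA mulmxA.
  by rewrite -(mulmxA w) w0 mul0mx mxE.
have fT : row_free (subcols X S)^T by rewrite /row_free mxrank_tr fr.
apply: (row_free_inj fT); rewrite mul0mx.
by apply: trmx_inj; rewrite trmx_mul trmxK XSw trmx0.
Qed.

Lemma projS_oproj S : fullrank X S -> oproj (projS X S).
Proof.
move=> /gram_unit Gu; rewrite /projS; split.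
  by rewrite !trmx_mul trmxK trmx_inv trmx_mul trmxK mulmxA.
by rewrite -!mulmxA; congr (_ *m _); rewrite (mulmxA _^T) mulKmx.
Qed.

Lemma projS_col S j : fullrank X S -> j \in S ->
  projS X S *m col j X = col j X.
Proof.
move=> /gram_unit Gu jS.
have <- : enum_val (enum_rank_in jS j) = j by rewrite enum_rankK_in.
rewrite -subcols_delta mulmxA /projS -!mulmxA; congr (_ *m _).
by rewrite (mulmxA _^T) mulKmx.
Qed.

Lemma mulmx_projS (V : 'M[R]_n) S :
  {in S, forall j, V *m col j X = col j X} -> V *m projS X S = projS X S.
Proof.
move=> VX; rewrite /projS !mulmxA; congr (_ *m _ *m _).
apply/matrixP => i k.
have /colP/(_ i) := VX _ (enum_valP k); rewrite !mxE => <-.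
by apply: eq_bigr => l _; rewrite !mxE.
Qed.

Lemma lse_quad S y : fullrank X S ->
  ((lse X S y)^T *m ((subcols X S)^T *m subcols X S) *m lse X S y) 0 0 =
  dot y (projS X S *m y).
Proof.
move=> /gram_unit Gu; rewrite /lse /projS /dot; congr (fun_of_matrix _ 0 0).
rewrite !trmx_mul trmxK trmx_inv trmx_mul trmxK -!mulmxA.
by congr (_ *m (_ *m _)); rewrite (mulmxA _^T) mulKmx.
Qed.

Section Truth.
Variable th : 'cV[R]_p.

(** [1 - P] annihilates the columns in [gam] and [th] vanishes off [gstar th], so only missed
    signals remain. *)
Lemma resid_mean gam : fullrank X gam ->
  (1%:M - projS X gam) *m (X *m th) =
  \sum_(j in gstar th :\: gam) th j 0 *: ((1%:M - projS X gam) *m col j X).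
Proof.
move=> fr; rewrite mulmx_cols mulmx_sumr [RHS]big_mkcond/=.
apply: eq_bigr => j _; rewrite -scalemxAr !inE.
case: ifPn => // /nandP[|]; last first.
  by rewrite negbK => /eqP ->; rewrite scale0r.
by rewrite negbK => jg; rewrite mulmxBl mul1mx projS_col// subrr scaler0.
Qed.

Lemma rhoX_le gam : fullrank X gam -> ~~ (gstar th \subset gam) ->
  rhoX X (gstar th) <= lambda_min ((n%:R)^-1 *:
    ((subcols X (gstar th :\: gam))^T *m (1%:M - projS X gam) *m
      subcols X (gstar th :\: gam))).
Proof.
move=> fr ngam; apply: ge_inf; last by exists gam.
pose f g := lambda_min ((n%:R)^-1 *:
  ((subcols X (gstar th :\: g))^T *m (1%:M - projS X g) *m subcols X (gstar th :\: g))).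
(* There are finitely many models, so this bounds the set below, as [ge_inf] requires. *)
exists (- \sum_g `|f g|) => _ [g [_ [_ ->]]]; rewrite -/(f g) lerNl.
apply: le_trans (ler_norm _) _; rewrite normrN (bigD1 g)//= lerDl.
exact: sumr_ge0.
Qed.

(** The squared norm is a quadratic form in the missed coefficients, and its matrix is among those
    minimized in [rhoX], so the Rayleigh bound applies. A model containing all signals is outside
    that infimum and leaves an empty sum. *)
Lemma signal_lower gam : (0 < n)%N -> fullrank X gam ->
  n%:R * rhoX X (gstar th) * \sum_(j in gstar th :\: gam) th j 0 ^+ 2 <=
  nsq ((1%:M - projS X gam) *m (X *m th)).
Proof.
move=> n0 fr; have [sub|nsub] := boolP (gstar th \subset gam).
  rewrite big_pred0 ?mulr0 ?nsq_ge0// => j; rewrite !inE.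
  by apply/negP => /andP[jg jt]; rewrite (fintype.subsetP sub) ?inE in jg.
set T := gstar th :\: gam; pose tT : 'cV[R]_#|T| := \col_k th (enum_val k) 0.
have oQ := oproj_compl (projS_oproj fr).
have -> : (1%:M - projS X gam) *m (X *m th) = (1%:M - projS X gam) *m (subcols X T *m tT).
  rewrite resid_mean// subcols_mul mulmx_sumr.
  by apply: eq_bigr => j _; rewrite scalemxAr.
rewrite -oproj_dot// dot_mull mulmxA mulmxA.
have -> : \sum_(j in T) th j 0 ^+ 2 = nsq tT.
  by rewrite nsqE [LHS]big_enum_val; apply: eq_bigr => k _; rewrite mxE.
set A := (subcols X T)^T *m _ *m _.
have n0' : 0 < n%:R :> R by rewrite ltr0n.
rewrite -mulrA -ler_pdivlMl// -(dotZr n%:R^-1) scalemxAl.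
apply: le_trans (lambda_min_rayleigh _ _); last first.
  by rewrite linearZ/= /A !trmx_mul trmxK (proj1 oQ) mulmxA.
by rewrite ler_wpM2r ?nsq_ge0// rhoX_le.
Qed.

(** Extending the true projection by the inactive columns gives the projection onto the span of all
    columns, which dominates every [projS X gam]; hence one list [us] serves all models. *)
Lemma inactive_directions : fullrank X (gstar th) ->
  exists us : seq 'cV[R]_n, [/\ size us = #|~: gstar th|,
    {in us, forall u, nsq u <= 1} &
    forall gam e, fullrank X gam ->
      dot e (projS X gam *m e) <=
      dot e (projS X (gstar th) *m e) + \sum_(u <- us) dot u e ^+ 2].
Proof.
move=> fr; have [us [sz nus oV VP Vs]] :=
  oproj_extend [seq col j X | j in ~: gstar th] (projS_oproj fr).
exists us; split => //; first by rewrite sz size_map -cardE.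
move=> gam e fg.
set V := (projS X (gstar th) + _) in oV VP Vs.
have VX j : V *m col j X = col j X.
  have [jg|jg] := boolP (j \in gstar th).
    by rewrite -{1}(projS_col fr jg) mulmxA VP projS_col.
  by apply: Vs; apply: map_f; rewrite mem_enum inE.
have -> : \sum_(u <- us) dot u e ^+ 2 = dot e ((\sum_(u <- us) u *m u^T) *m e).
  rewrite mulmx_suml dot_sumr; apply: eq_bigr => u _.
  by rewrite -mulmxA [u^T *m e]mx11_scalar -/(dot u e) mul_mx_scalar dotZr (dotC e) expr2.
rewrite -dotDr -mulmxDl; apply: oproj_le => //; first exact: projS_oproj.
by apply: mulmx_projS => j _.
Qed.

(* Only the inactive directions contribute quadratic noise; missed signals
   enter linearly because [|(1 - P) e|^2] is kept on the favourable side. *)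
Lemma projection_gap (us : seq 'cV[R]_n) (phi : R) gam e :
  0 <= phi -> fullrank X (gstar th) -> fullrank X gam ->
  dot e (projS X gam *m e) <=
    dot e (projS X (gstar th) *m e) + \sum_(u <- us) dot u e ^+ 2 ->
  forall y m, y = X *m th + Num.sqrt phi *: e ->
  m = (1%:M - projS X gam) *m (X *m th) ->
  dot y (projS X gam *m y) - dot y (projS X (gstar th) *m y) <=
  - nsq m - 2 * Num.sqrt phi * dot m e + phi * \sum_(u <- us) dot u e ^+ 2.
Proof.
move=> phi0 frs frg ge y m yE mE.
have os := projS_oproj frs; have og := projS_oproj frg.
have m0 : (1%:M - projS X (gstar th)) *m (X *m th) = 0.
  by rewrite resid_mean// finset.setDv finset.big_set0.
have -> : dot y (projS X gam *m y) = nsq y - nsq ((1%:M - projS X gam) *m y).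
  by rewrite nsq_compl// subKr.
have -> : dot y (projS X (gstar th) *m y) =
    nsq y - nsq ((1%:M - projS X (gstar th)) *m y).
  by rewrite nsq_compl// subKr.
move: (nsq y) => Y; rewrite yE !(mulmxDr (1%:M - _)) m0 add0r -!scalemxAr -mE nsqD (dotZr _ m) !nsqZ sqr_sqrtr//.
have -> : dot m ((1%:M - projS X gam) *m e) = dot m e.
  have [cT cc] := oproj_compl og.
  by rewrite -cT -dot_mull mE mulmxA cc.
rewrite !nsq_compl//; nra.
Qed.

End Truth.
End Design.

(** * Posterior model probabilities *)

(* The factor by which the prior and the Zellner penalty multiply the weight of
   a model when a covariate of block [b] is added. *)
Definition prior_odds (R : realType) (B n : nat) (g : R) (om : 'I_B -> R) (b : 'I_B) : R :=
  om b / (Num.sqrt (1 + g * n%:R) * (1 - om b)).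

Section Posterior.
Variables (R : realType) (n p B : nat) (X : 'M[R]_(n, p)) (th : 'cV[R]_p).
Variables (z : 'I_p -> 'I_B) (phi g : R).
Hypotheses (phi0 : 0 < phi) (g0 : 0 < g).
Hypothesis frs : fullrank X (gstar th).
Implicit Types (gam : {set 'I_p}) (om : 'I_B -> R) (y : 'cV[R]_n) (x : 'I_p -> R).

Let gs := gstar th.
Local Notation odds := (prior_odds n g).

Definition symdiff gam gam' := (gam :\: gam') :|: (gam' :\: gam).
Definition shrink := g * n%:R / (1 + g * n%:R).
Definition resid gam := (1%:M - projS X gam) *m (X *m th).
(** Deterministic part of the bound on the square root of the weight ratio of [gam] to the true
    model, whence 4 and not 2 in the denominator; [x j] bounds the square root of the prior factor
    for misclassifying [j]. *)
Definition atten gam x : R :=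
  expR (- (shrink / (4 * phi) * nsq (resid gam))) * \prod_(j in symdiff gs gam) x j.

Let gn0 : 0 < 1 + g * n%:R.
Proof. by rewrite ltr_pwDl// mulr_ge0// ltW. Qed.

Lemma shrink_ge0 : 0 <= shrink.
Proof. by rewrite divr_ge0 ?(ltW gn0)// mulr_ge0 ?(ltW g0). Qed.

Lemma shrink_le1 : shrink <= 1.
Proof. by rewrite ler_pdivrMr// mul1r lerDr. Qed.

Lemma fullrank0 : fullrank X finset.set0.
Proof.
by rewrite /fullrank; move: (subcols X finset.set0); rewrite cards0 => A; rewrite -leqn0 rank_leq_col.
Qed.

Lemma prod_pgam (a : 'I_B -> R) gam :
  \prod_(b < B) a b ^+ pgam z gam b = \prod_(j in gam) a (z j).
Proof.
rewrite (partition_big z predT)//=; apply: eq_bigr => b _.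
rewrite /pgam -prodr_const; rewrite [LHS](eq_bigl (fun j => (j \in gam) && (z j == b))).
  by apply: eq_bigr => j /andP[_ /eqP ->].
by move=> j; rewrite inE.
Qed.

Lemma post_weightE om y gam : fullrank X gam ->
  post_weight X z phi g om y gam =
  expR (shrink / (2 * phi) * dot y (projS X gam *m y)) * \prod_(j in gam) odds om (z j).
Proof.
move=> fr; rewrite /post_weight lse_quad// prod_pgam; congr (expR _ * _).
by rewrite /shrink; field; rewrite !gt_eqF.
Qed.

Section Odds.
Variables (om : 'I_B -> R) (y : 'cV[R]_n).
Hypothesis om0 : forall j : 'I_p, 0 < odds om (z j).

Lemma post_weight_gt0 gam : 0 < post_weight X z phi g om y gam.
Proof.
rewrite /post_weight mulr_gt0 ?expR_gt0// prod_pgam.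
by apply: prodr_gt0 => j _; exact: om0.
Qed.

Lemma post_total_gt0 :
  0 < \sum_(gam : {set 'I_p} | fullrank X gam) post_weight X z phi g om y gam.
Proof.
rewrite (bigD1 gs)//= ltr_pwDl ?post_weight_gt0//.
by apply: sumr_ge0 => gam _; rewrite ltW ?post_weight_gt0.
Qed.

Lemma posterior_ge0 gam : 0 <= posterior X z phi g om y gam.
Proof.
rewrite /posterior; case: ifP => // _.
by rewrite divr_ge0 ?ltW ?post_weight_gt0 ?post_total_gt0.
Qed.

Lemma posterior_gt0 gam : fullrank X gam -> 0 < posterior X z phi g om y gam.
Proof.
by move=> fr; rewrite /posterior fr divr_gt0 ?post_weight_gt0 ?post_total_gt0.
Qed.

Lemma posterior_sum : \sum_gam posterior X z phi g om y gam = 1.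
Proof.
rewrite /posterior -big_mkcond/= -mulr_suml mulfV// gt_eqF//.
exact: post_total_gt0.
Qed.

Lemma posterior_le1 gam : posterior X z phi g om y gam <= 1.
Proof.
rewrite -posterior_sum (bigD1 gam)//= lerDl; apply: sumr_ge0 => ? _.
exact: posterior_ge0.
Qed.

Lemma posterior_compl :
  1 - posterior X z phi g om y gs = \sum_(gam | gam != gs) posterior X z phi g om y gam.
Proof. by apply/eqP; rewrite subr_eq -[eqbLHS]posterior_sum (bigD1 gs)//= addrC. Qed.

(* [r <= min (1, ratio) <= sqrt ratio] *)
Lemma posterior_le_sqrt gam (b : R) : 0 <= b -> fullrank X gam ->
  post_weight X z phi g om y gam <= b ^+ 2 * post_weight X z phi g om y gs ->
  posterior X z phi g om y gam <= b.
Proof.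
move=> b0 fr wb; rewrite -ler_sqr ?nnegrE ?posterior_ge0//.
have r0 := posterior_ge0 gam; have r1 := posterior_le1 gam.
apply: (@le_trans _ _ (posterior X z phi g om y gam)).
  by rewrite expr2 ler_piMr.
rewrite /posterior fr ler_pdivrMr ?post_total_gt0//.
apply: le_trans wb _; rewrite ler_wpM2l ?sqr_ge0// (bigD1 gs)//= lerDl.
by apply: sumr_ge0 => ? _; rewrite ltW ?post_weight_gt0.
Qed.

Lemma incl_prob_compl j :
  1 - incl_prob X z phi g om y j =
  \sum_(gam : {set 'I_p} | j \notin gam) posterior X z phi g om y gam.
Proof.
apply/eqP; rewrite subr_eq -[eqbLHS]posterior_sum.
by rewrite (bigID (fun gam : {set 'I_p} => j \in gam))/= addrC.
Qed.

(** The empty model omits [j] and has positive posterior probability. Strictness keeps [omega1]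
    below 1, so that its odds are positive. *)
Lemma incl_prob_lt1 j : incl_prob X z phi g om y j < 1.
Proof.
rewrite -subr_gt0 incl_prob_compl (bigD1 finset.set0)/= ?inE//.
rewrite ltr_pwDl ?posterior_gt0 ?fullrank0//.
by apply: sumr_ge0 => ? _; exact: posterior_ge0.
Qed.

Definition incl_dev j : R :=
  if j \in gs then 1 - incl_prob X z phi g om y j else incl_prob X z phi g om y j.

Lemma incl_dev_ge0 j : 0 <= incl_dev j.
Proof.
rewrite /incl_dev; case: ifP => _.
  by rewrite incl_prob_compl; apply: sumr_ge0 => ? _; exact: posterior_ge0.
by apply: sumr_ge0 => ? _; exact: posterior_ge0.
Qed.

(** Exchanging sums, each model contributes its probability once per covariate that it
    misclassifies. *)
Lemma sum_incl_dev :
  \sum_j incl_dev j =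
  \sum_(gam | gam != gs) posterior X z phi g om y gam * #|symdiff gs gam|%:R.
Proof.
have -> : \sum_j incl_dev j =
    \sum_j \sum_gam posterior X z phi g om y gam * (j \in symdiff gs gam)%:R.
  apply: eq_bigr => j _; rewrite /incl_dev incl_prob_compl /incl_prob.
  case: ifP => jgs; rewrite big_mkcond/=; apply: eq_bigr => gam _;
    by rewrite /symdiff finset.in_setU !finset.in_setD jgs; case: (j \in gam); rewrite /= ?mulr1 ?mulr0.
rewrite exchange_big/= (bigD1 gs)//= big1 ?add0r; last first.
  by move=> j _; rewrite /symdiff finset.setDv finset.setU0 inE mulr0.
apply: eq_bigr => gam _; rewrite -mulr_sumr; congr (_ * _).
by rewrite -sum1_card natr_sum [RHS]big_mkcond; apply: eq_bigr => j _; case: ifP.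
Qed.

End Odds.

Variable us : seq 'cV[R]_n.
Hypothesis usP : forall gam e, fullrank X gam ->
  dot e (projS X gam *m e) <= dot e (projS X gs *m e) + \sum_(u <- us) dot u e ^+ 2.

Section Draw.
Variables (e : 'cV[R]_n) (tau : R).
Hypothesis taue : \sum_(u <- us) dot u e ^+ 2 <= tau.
Let y := X *m th + Num.sqrt phi *: e.

Definition linterm gam : R := expR (- (shrink / (2 * Num.sqrt phi)) * dot (resid gam) e).

(** An application of [posterior_le_sqrt]. The likelihood ratio is bounded by [projection_gap],
    whose quadratic noise contributes at most [tau / 2] to the exponent before the root is taken; in
    the prior ratio all correctly classified covariates cancel. *)
Lemma posterior_le_atten om x gam :
  (forall j : 'I_p, 0 < odds om (z j)) -> (forall j, 0 <= x j) ->
  {in gs, forall j, (odds om (z j))^-1 <= x j ^+ 2} ->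
  (forall j, j \notin gs -> odds om (z j) <= x j ^+ 2) ->
  fullrank X gam ->
  posterior X z phi g om y gam <= expR (tau / 4) * (atten gam x * linterm gam).
Proof.
move=> om0 x0 xs xn fr.
have prod0 : 0 <= \prod_(j in symdiff gs gam) x j by apply: prodr_ge0 => j _.
apply: posterior_le_sqrt => //.
  by rewrite !mulr_ge0 ?expR_ge0.
rewrite !post_weightE// /atten.
set L := linterm gam.
rewrite !exprMn.
have expE : expR (shrink / (2 * phi) * dot y (projS X gam *m y)) <=
    expR (tau / 4) ^+ 2 * (expR (- (shrink / (4 * phi) * nsq (resid gam))) ^+ 2 * L ^+ 2) *
    expR (shrink / (2 * phi) * dot y (projS X gs *m y)).
  rewrite /L /linterm -!expRM_natl -!expRD ler_expR.
  have := projection_gap (ltW phi0) frs fr (usP e fr) erefl erefl.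
  rewrite -/y -/(resid gam) -/gs => gap.
  have hp : 0 <= shrink / (2 * phi) by rewrite divr_ge0 ?shrink_ge0 ?mulr_ge0 ?ltW.
  have := ler_wpM2l hp gap; rewrite mulrBr lerBlDr => /le_trans; apply.
  rewrite lerD2r.
  have sp : 0 < Num.sqrt phi by rewrite sqrtr_gt0.
  have -> : shrink / (2 * phi) * (- nsq (resid gam) - 2 * Num.sqrt phi * dot (resid gam) e
      + phi * \sum_(u <- us) dot u e ^+ 2) =
    - (shrink / (2 * phi) * nsq (resid gam)) - shrink * (Num.sqrt phi / phi) * dot (resid gam) e
      + shrink / 2 * \sum_(u <- us) dot u e ^+ 2.
    by field; rewrite gt_eqF.
  have -> : Num.sqrt phi / phi = (Num.sqrt phi)^-1.
    by rewrite -{2}[phi]sqr_sqrtr ?ltW// expr2 invfM mulVKf// gt_eqF.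
  have -> : 2 * (tau / 4) + (2 * - (shrink / (4 * phi) * nsq (resid gam)) +
      2 * (- (shrink / (2 * Num.sqrt phi)) * dot (resid gam) e)) =
    - (shrink / (2 * phi) * nsq (resid gam)) - shrink * (Num.sqrt phi)^-1 * dot (resid gam) e
      + tau / 2.
    by field; rewrite !gt_eqF.
  rewrite lerD2l mulrAC ler_wpM2r ?invr_ge0//.
  apply: le_trans taue; rewrite ler_piMl ?shrink_le1//.
  by apply: sumr_ge0 => u _; exact: sqr_ge0.
have prodE : \prod_(j in gam) odds om (z j) <=
    (\prod_(j in symdiff gs gam) x j) ^+ 2 * \prod_(j in gs) odds om (z j).
  rewrite -prodrXl big_mkcond [X in X * _]big_mkcond [X in _ * X]big_mkcond -big_split/=.
  apply: ler_prod => j _; rewrite /symdiff !finset.in_setU !finset.in_setD.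
  have oj := om0 j.
  case: (boolP (j \in gam)) => jg; case: (boolP (j \in gs)) => js /=; rewrite ?mul1r ?mulr1 ?ler01 ?lexx//.
  - by rewrite (ltW oj).
  - by rewrite (ltW oj) xn.
  - by rewrite -ler_pdivrMr// div1r xs.
have o0 (A : {set 'I_p}) : 0 <= \prod_(j in A) odds om (z j).
  by apply: prodr_ge0 => j _; exact/ltW.
apply: le_trans (ler_pM (expR_ge0 _) (o0 _) expE prodE) _.
by rewrite le_eqVlt; apply/orP; left; apply/eqP; ring.
Qed.

Definition attsum x : R := \sum_(gam | fullrank X gam && (gam != gs)) atten gam x * linterm gam.

(** A factor [c] per misclassified covariate is absorbed into the penalties; [c = 2] serves the
    inclusion probabilities and [c = 1] the posterior itself. *)
Lemma posterior_sum_le_attsum om x (c : nat) :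
  (forall j : 'I_p, 0 < odds om (z j)) -> (forall j, 0 <= x j) ->
  {in gs, forall j, (odds om (z j))^-1 <= x j ^+ 2} ->
  (forall j, j \notin gs -> odds om (z j) <= x j ^+ 2) ->
  \sum_(gam | gam != gs) posterior X z phi g om y gam * c%:R ^+ #|symdiff gs gam| <=
  expR (tau / 4) * attsum (fun j => c%:R * x j).
Proof.
move=> om0 x0 xs xn.
rewrite /attsum mulr_sumr [leRHS]big_mkcond [leLHS]big_mkcond/=.
apply: ler_sum => gam _; case: eqVneq => //= ngs; rewrite ?andbF// andbT.
case: ifPn => fr; last by rewrite /posterior (negPf fr) mul0r.
rewrite /atten big_split/= prodr_const.
have /ler_wpM2r := posterior_le_atten om0 x0 xs xn fr.
move=> /(_ (c%:R ^+ #|symdiff gs gam|)); rewrite exprn_ge0// => /(_ isT) /le_trans; apply.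
rewrite /atten le_eqVlt; apply/orP; left; apply/eqP; ring.
Qed.

End Draw.
End Posterior.

(** * The two-step bound for a fixed sample size *)

(* In [pblk] the comprehension is a classical set, not a finite one. *)
Lemma mem_block (p B : nat) (z : 'I_p -> 'I_B) (b : 'I_B) (j : 'I_p) :
  (j \in [set i | z i == b]%classic) = (z j == b).
Proof. by apply/idP/idP => [/set_mem|/mem_set]. Qed.

Section TwoStep.
Variables (R : realType) (n p B : nat) (X : 'M[R]_(n, p)) (th : 'cV[R]_p).
Variables (z : 'I_p -> 'I_B) (phi g : R).
Hypotheses (n0 : (0 < n)%N) (phi0 : 0 < phi) (g0 : 0 < g).
Hypothesis frs : fullrank X (gstar th).
Hypothesis s0 : forall b, (0 < sblk z th b)%N.
Implicit Types (gam : {set 'I_p}) (y : 'cV[R]_n) (x : 'I_p -> R).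

Let gs := gstar th.
Let G := Num.sqrt (1 + g * n%:R).
Let om0 := @omega0 R p B.
Let om1 y := omega1 X z phi g y.
Let s b : R := (sblk z th b)%:R.
Let d b : R := (pblk z b - sblk z th b)%:R.

Local Notation odds := (prior_odds n g).

Let G0 : 0 < G.
Proof. by rewrite sqrtr_gt0 ltr_pwDl// mulr_ge0// ltW. Qed.

Lemma omega0_odds (b : 'I_B) : (0 < p)%N -> odds om0 b = (p%:R * G)^-1.
Proof.
move=> p0; have p0' : 0 < p%:R :> R by rewrite ltr0n.
rewrite /prior_odds -/G /om0 /omega0; field.
by rewrite !gt_eqF//= ?addrK// ltr_pwDr// ltW.
Qed.

Let odds0_gt0 (j : 'I_p) : 0 < odds om0 (z j).
Proof.
have p0 : (0 < p)%N by case: j => k; case: (p).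
by rewrite omega0_odds// invr_gt0 mulr_gt0// ltr0n.
Qed.

Let sp b : s b <= (pblk z b)%:R.
Proof.
rewrite ler_nat; apply: subset_leq_card; apply/fintype.subsetP => j.
by rewrite mem_block inE => /andP[].
Qed.

Let dE b : d b = (pblk z b)%:R - s b.
Proof. by rewrite /d natrB// -(ler_nat R) sp. Qed.

(** Posterior expected number of selected covariates in block [b], that is, [p_b] times [omega1]. *)
Let S1 y b := \sum_(j | z j == b) incl_prob X z phi g om0 y j.

Let S1_gt0 y b : 0 < S1 y b.
Proof.
have := s0 b; rewrite card_gt0 => /finset.set0Pn[j]; rewrite inE => /andP[js jb].
have pi0 i : 0 <= incl_prob X z phi g om0 y i.
  by apply: sumr_ge0 => gam _; exact: (posterior_ge0 phi frs y odds0_gt0).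
rewrite /S1 (bigD1 j)//=; apply: ltr_pwDl; last exact: sumr_ge0.
rewrite /incl_prob (bigD1 gs)//=; apply: ltr_pwDl; first exact: (posterior_gt0 phi frs y odds0_gt0).
by apply: sumr_ge0 => gam _; exact: (posterior_ge0 phi frs y odds0_gt0).
Qed.

Let pblkE b : (pblk z b)%:R = \sum_(j | z j == b) (1 : R).
Proof.
rewrite /pblk -sum1_card natr_sum big_mkcond [RHS]big_mkcond/=.
by apply: eq_bigr => j _; rewrite mem_block.
Qed.

Let S1_ltp y b : S1 y b < (pblk z b)%:R.
Proof.
have := s0 b; rewrite card_gt0 => /finset.set0Pn[j]; rewrite inE => /andP[js jb].
rewrite -subr_gt0 pblkE /S1 -sumrB (bigD1 j)//= ltr_pwDl//.
  by rewrite subr_gt0 (incl_prob_lt1 _ frs _ odds0_gt0).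
by apply: sumr_ge0 => i _; rewrite subr_ge0 ltW// (incl_prob_lt1 _ frs _ odds0_gt0).
Qed.

Let om1_odds y b :
  odds (om1 y) b = S1 y b / (G * ((pblk z b)%:R - S1 y b)).
Proof.
have h1 := S1_ltp y b; have h0 := S1_gt0 y b.
have p0 : 0 < (pblk z b)%:R :> R by apply: lt_trans h1.
rewrite /prior_odds -/G /om1 /omega1 -/om0 -/(S1 y b); field.
rewrite !gt_eqF//= ?subr_gt0//.
Qed.

Lemma omega1_odds_gt0 y b : 0 < odds (om1 y) b.
Proof. by rewrite om1_odds divr_gt0// mulr_gt0// subr_gt0. Qed.

(** The assumption gives [|S1 - s| <= 1/2]. As [s >= 1], this yields [S1 >= s / 2] and
    [p_b - S1 <= d + 1/2]; if [d >= 1], also [S1 <= 3 s / 2] and [p_b - S1 >= 1/2]. *)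
Lemma omega1_odds_bounds y b :
  \sum_j incl_dev X th z phi g om0 y j <= 2^-1 ->
  (odds (om1 y) b)^-1 <= 2 * (d b + 1) * G / s b /\
  (1 <= d b -> odds (om1 y) b <= 3 * s b / G).
Proof.
move=> dev; have h1 := S1_ltp y b; have h0 := S1_gt0 y b.
have s1 : 1 <= s b by rewrite ler1n.
have Ss : `|S1 y b - s b| <= 2^-1.
  apply: le_trans dev.
  have -> : s b = \sum_(j | z j == b) (j \in gs)%:R.
    rewrite /s /sblk /pgam -sum1_card natr_sum big_mkcond [RHS]big_mkcond/=.
    by apply: eq_bigr => j _; rewrite finset.in_set -/gs; case: (z j == b); case: (j \in gs).
  rewrite /S1 -sumrB; apply: le_trans (ler_norm_sum _ _ _) _.
  rewrite big_mkcond/=; apply: ler_sum => j _.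
  have dev0 := incl_dev_ge0 phi frs y odds0_gt0 j.
  case: ifP => // _; move: dev0; rewrite /incl_dev; case: (j \in gs) => dev0.
    by rewrite distrC ger0_norm.
  by rewrite subr0 ger0_norm.
move: Ss; rewrite ler_norml => /andP[Sl Su].
have := dE b; rewrite om1_odds; move: (S1 y b) (pblk z b)%:R (d b) (s b) s1 h0 h1 Sl Su.
move=> S P D q q1 S0 SP Sl Su DE.
split.
  have q0 : 0 < q by lra.
  have PSD : P - S <= D + 2^-1 by lra.
  have D1 : 0 <= D + 2^-1 by lra.
  have key : (P - S) * q <= 2 * (D + 1) * S.
    have h1 := ler_wpM2r (ltW q0) PSD.
    have h2 : 0 <= (S - q + 2^-1) * (D + 2^-1) by rewrite mulr_ge0//; lra.
    have h3 : 0 <= (q - 1) * (D + 2^-1) by rewrite mulr_ge0//; lra.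
    by nra.
  rewrite invf_div ler_pdivrMr// mulrAC ler_pdivlMr//.
  have -> : G * (P - S) * q = G * ((P - S) * q) by ring.
  have -> : 2 * (D + 1) * G * S = G * (2 * (D + 1) * S) by ring.
  by rewrite ler_wpM2l// ltW.
move=> D0; rewrite ler_pdivrMr ?mulr_gt0 ?subr_gt0// mulrA divfK ?gt_eqF//.
have h1 : 0 <= q * (P - S - 2^-1) by rewrite mulr_ge0//; lra.
by nra.
Qed.

Let h := shrink n g.
Let h_ge0 : 0 <= h := shrink_ge0 n g0.
Let h_le1 : h <= 1 := shrink_le1 n g0.

(** The share of covariate [j] in the bound of [signal_lower], in units of the noise variance; it
    vanishes for inactive [j]. *)
Definition signal (j : 'I_p) : R := n%:R * rhoX X gs * th j 0 ^+ 2 / phi.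

(** A model is determined by its symmetric difference with [gs], so the product is expanded over all
    subsets and the empty one removed. The two summands are swapped on [gs] to make the chosen
    subset [gam] itself. *)
Lemma sum_symdiff_prod (c : 'I_p -> R) :
  \sum_(gam | gam != gs) \prod_(j in symdiff gs gam) c j = \prod_j (1 + c j) - 1.
Proof.
have -> : \prod_j (1 + c j) = \prod_j ((if j \in gs then 1 else c j) + (if j \in gs then c j else 1)).
  by apply: eq_bigr => j _; case: ifP => //; rewrite addrC.
rewrite bigA_distr [in RHS](bigD1 gs)//= [X in X + _ - _]big1; last by move=> j _; case: (j \in gs).
rewrite addrAC subrr add0r; apply: eq_bigr => gam _; rewrite big_mkcond/=.
apply: eq_bigr => j _; rewrite /symdiff finset.in_setU !finset.in_setD.
by case: (j \in gam); case: (j \in gs).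
Qed.

(* The Gaussian mean of [atten gam x * linterm gam]: the linear noise costs
   only half of the quadratic attenuation. *)
Lemma atten_mean x : (forall j, 0 <= x j) ->
  \sum_(gam | fullrank X gam && (gam != gs))
     atten X th phi g gam x *
     expR ((h / (2 * Num.sqrt phi)) ^+ 2 * nsq (resid X th gam) / 2) <=
  expR (\sum_j x j * expR (- (h / 8 * signal j))) - 1.
Proof.
move=> x0; set c := fun j => x j * expR (- (h / 8 * signal j)).
have c0 j : 0 <= c j by rewrite mulr_ge0 ?expR_ge0.
apply: (@le_trans _ _ (\sum_(gam | gam != gs) \prod_(j in symdiff gs gam) c j)); last first.
  rewrite sum_symdiff_prod lerB// expR_sum; apply: ler_prod => j _.
  by rewrite expR_ge1Dx addr_ge0.
rewrite [leRHS]big_mkcond [leLHS]big_mkcond/=; apply: ler_sum => gam _.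
case: (gam != gs); rewrite ?andbF// andbT; case: ifPn => fr; last exact: prodr_ge0.
rewrite /atten mulrAC big_split/= mulrC; apply: ler_wpM2l; first exact: prodr_ge0.
rewrite -expRD -expR_sum ler_expR sumrN lerNr -mulr_sumr.
have sq : Num.sqrt phi ^+ 2 = phi by rewrite sqr_sqrtr// ltW.
have -> : (h / (2 * Num.sqrt phi)) ^+ 2 = h ^+ 2 / (4 * phi).
  by rewrite -{2}sq; field; rewrite gt_eqF// sqrtr_gt0.
have low : \sum_(j in symdiff gs gam) signal j <= nsq (resid X th gam) / phi.
  apply: le_trans (_ : n%:R * rhoX X gs * (\sum_(j in gs :\: gam) th j 0 ^+ 2) / phi <= _); last first.
    by rewrite ler_pM2r ?invr_gt0//; exact: signal_lower.
  rewrite mulr_sumr mulr_suml [leRHS]big_mkcond [leLHS]big_mkcond/=.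
  apply: ler_sum => j _; rewrite /symdiff finset.in_setU !finset.in_setD.
  have [jg|jg] := boolP (j \in gam); have [js|js] := boolP (j \in gs) => //=.
  by rewrite /signal; move: js; rewrite inE negbK => /eqP ->; rewrite expr0n mulr0 mul0r.
move: low; rewrite -/h; move: (\sum_(j in _) _) => S low.
set N := nsq _ in low *.
have N0 : 0 <= N / phi by rewrite divr_ge0 ?nsq_ge0 ?ltW.
have -> : - (- (h / (4 * phi) * N) + h ^+ 2 / (4 * phi) * N / 2) =
    (h / 4 - h ^+ 2 / 8) * (N / phi) by field; rewrite gt_eqF.
apply: (@le_trans _ _ (h / 8 * (N / phi))).
  by rewrite ler_wpM2l// divr_ge0.
rewrite ler_wpM2r//; have : h * h <= h by rewrite ler_piMr.
by rewrite expr2; lra.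
Qed.

(** Noise enters [gexp] as a sequence on the naturals, so vectors are padded with 0. *)
Definition vext (v : 'cV[R]_n) (i : nat) : R := if insub i is Some j then v j 0 else 0.

Lemma vext_ord (v : 'cV[R]_n) (i : 'I_n) : vext v i = v i 0.
Proof. by rewrite /vext valK. Qed.

(** Square roots of the inverse odds (active) and of the odds (inactive) under [omega0], times the
    factor 2 that counts errors in [step1_dev]. *)
Definition pen1 (j : 'I_p) : R :=
  if j \in gs then 2 * Num.sqrt (p%:R * G) else 2 * (Num.sqrt (p%:R * G))^-1.

(** Square roots of the two bounds of [omega1_odds_bounds]. *)
Definition pen2 (j : 'I_p) : R :=
  if j \in gs then Num.sqrt (2 * (d (z j) + 1) * G / s (z j))
  else Num.sqrt (3 * s (z j) / G).

Let pen1_ge0 j : 0 <= pen1 j.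
Proof. by rewrite /pen1; case: ifP => _; rewrite mulr_ge0 ?invr_ge0 ?sqrtr_ge0. Qed.

Let pen2_ge0 j : 0 <= pen2 j.
Proof. by rewrite /pen2; case: ifP => _; rewrite sqrtr_ge0. Qed.

Lemma attsum_ge0 (e : 'cV[R]_n) x : (forall j, 0 <= x j) -> 0 <= attsum X th phi g e x.
Proof.
move=> x0; apply: sumr_ge0 => gam _.
by rewrite mulr_ge0 ?expR_ge0// mulr_ge0 ?expR_ge0//; apply: prodr_ge0.
Qed.

Section Event.
Variable us : seq 'cV[R]_n.
Hypothesis usP : forall gam e, fullrank X gam ->
  dot e (projS X gam *m e) <= dot e (projS X gs *m e) + \sum_(u <- us) dot u e ^+ 2.
Variables (e : 'cV[R]_n) (tau : R).
Hypothesis taue : \sum_(u <- us) dot u e ^+ 2 <= tau.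
Let y := X *m th + Num.sqrt phi *: e.
Let K := expR (tau / 4).

Lemma step1_dev : \sum_j incl_dev X th z phi g om0 y j <= K * attsum X th phi g e pen1.
Proof.
rewrite (sum_incl_dev phi frs y odds0_gt0) -/gs.
(* A count [k] is at most [2 ^ k], which is a product over the misclassified covariates. *)
apply: (@le_trans _ _ (\sum_(gam | gam != gs)
    posterior X z phi g om0 y gam * 2%:R ^+ #|symdiff gs gam|)).
  apply: ler_sum => gam _; apply: ler_wpM2l.
    exact: (posterior_ge0 phi frs y odds0_gt0).
  by rewrite -natrX ler_nat ltnW// ltn_expl.
have pGi (j : 'I_p) : 0 < p%:R * G.
  by have p0 : (0 < p)%N by [case: j => k; case: (p)]; rewrite mulr_gt0// ltr0n.
pose x j := if j \in gs then Num.sqrt (p%:R * G) else (Num.sqrt (p%:R * G))^-1.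
have pen1E : pen1 = (fun j => 2%:R * x j).
  by apply/funext => j; rewrite /pen1 /x; case: ifP.
have p0 (j : 'I_p) : (0 < p)%N by case: j => k; case: (p).
rewrite pen1E; apply: (posterior_sum_le_attsum phi0 g0 frs usP taue).
- exact: odds0_gt0.
- by move=> j; rewrite /x; case: ifP => _; rewrite ?invr_ge0 sqrtr_ge0.
- move=> j js; rewrite omega0_odds ?(p0 j)// invrK /x js sqr_sqrtr//.
  by rewrite ltW// (pGi j).
- move=> j js; rewrite omega0_odds ?(p0 j)// /x (negPf js) exprVn sqr_sqrtr//.
  by rewrite ltW// (pGi j).
Qed.

Lemma step2_posterior : K * attsum X th phi g e pen1 <= 2^-1 ->
  1 - posterior X z phi g (om1 y) y gs <= K * attsum X th phi g e pen2.
Proof.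
move=> /(le_trans step1_dev) dev.
have o1 (j : 'I_p) : 0 < odds (om1 y) (z j) by exact: omega1_odds_gt0.
have b1 b := omega1_odds_bounds b dev.
rewrite (posterior_compl phi frs y o1).
have -> : pen2 = (fun j => 1%:R * pen2 j) by apply/funext => j; rewrite mul1r.
have := @posterior_sum_le_attsum _ _ _ _ X th z _ _ phi0 g0 frs us usP e tau taue (om1 y) pen2 1 o1 pen2_ge0.
under eq_bigr do rewrite expr1n mulr1.
apply => [j js|j js].
  rewrite /pen2 (_ : (j \in gs) = true)// sqr_sqrtr; first by have [] := b1 (z j).
  by rewrite divr_ge0// mulr_ge0 ?(ltW G0)// mulr_ge0// addr_ge0.
rewrite /pen2 (negPf js) sqr_sqrtr; last by rewrite divr_ge0 ?(ltW G0)// mulr_ge0.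
(* The inactive [j] itself witnesses [p_b > s_b], the condition of the second odds bound. *)
have [_] := b1 (z j); apply.
rewrite dE lerBrDl natr1 ler_nat; apply: proper_card; apply/fintype.properP; split.
  by apply/fintype.subsetP => i; rewrite mem_block finset.in_set => /andP[].
by exists j; rewrite ?mem_block// finset.in_set negb_and js.
Qed.

End Event.

(** The posterior is at least 1 minus a sum of exponentials of linear forms, averaged by
    [gexp_ge_expsum]. The three terms pay for a large [u.e], for failure of the first step, and for
    wrong models in the second. *)
Lemma two_step_bound (t : R) : 0 <= t ->
  let D := #|~: gs|%:R in
  let K := expR (D * t ^+ 2 / 4) in
  let E := gexp n (fun e => posterior X z phi g
      (om1 (ydraw X th phi e)) (ydraw X th phi e) gs) in
  E <= 1 /\
  1 - (2 * D * expR (- (t ^+ 2 / 2)) +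
       2 * K * (expR (\sum_j pen1 j * expR (- (h / 8 * signal j))) - 1) +
       K * (expR (\sum_j pen2 j * expR (- (h / 8 * signal j))) - 1)) <= E.
Proof.
move=> t0 D K E.
have [us [szus nus usP]] := inactive_directions frs.
pose coef gam := 2 * K * atten X th phi g gam pen1 + K * atten X th phi g gam pen2.
pose hv gam := (- (h / (2 * Num.sqrt phi))) *: resid X th gam.
pose gams := [seq gam <- index_enum {set 'I_p} | fullrank X gam && (gam != gs)].
(* If some [|u.e| > t], one of [exp (- t^2 + t u.e)] and [exp (- t^2 - t u.e)] exceeds 1, while
   their means are at most [exp (- t^2 / 2)]. The coefficient [2 K] makes the [pen1] part exceed 1
   when the first-step bound exceeds 1/2. *)
pose l : seq (R * (nat -> R)) :=
  [seq (expR (- t ^+ 2), vext (t *: u)) | u <- us] ++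
  [seq (expR (- t ^+ 2), vext ((- t) *: u)) | u <- us] ++
  [seq (coef gam, vext (hv gam)) | gam <- gams].
have K0 : 0 <= K by exact: expR_ge0.
have ydE (e : nat -> R) : ydraw X th phi e = X *m th + Num.sqrt phi *: (\col_(i < n) e i) by [].
have F01 (e : nat -> R) : 0 <= posterior X z phi g (om1 (ydraw X th phi e)) (ydraw X th phi e) gs <= 1.
  have o1 (j : 'I_p) : 0 < odds (om1 (ydraw X th phi e)) (z j) by exact: omega1_odds_gt0.
  by rewrite (posterior_ge0 phi frs _ o1) (posterior_le1 phi frs _ o1).
have vdot (v : 'cV[R]_n) (e : nat -> R) : \sum_(i < n) vext v i * e i = dot v (\col_(i < n) e i).
  by rewrite dotE; apply: eq_bigr => i _; rewrite vext_ord mxE.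
have vnsq (v : 'cV[R]_n) : \sum_(i < n) vext v i ^+ 2 = nsq v.
  by rewrite nsqE; apply: eq_bigr => i _; rewrite vext_ord.
have coefsum (w : {set 'I_p} -> R) : \sum_(gam <- gams) coef gam * w gam =
    2 * K * (\sum_(gam | fullrank X gam && (gam != gs)) atten X th phi g gam pen1 * w gam) +
    K * (\sum_(gam | fullrank X gam && (gam != gs)) atten X th phi g gam pen2 * w gam).
  rewrite big_filter !mulr_sumr -big_split/=; apply: eq_bigr => gam _.
  by rewrite /coef; ring.
suff lowF (e : nat -> R) : 1 - \sum_(cv <- l) cv.1 * expR (\sum_(i < n) cv.2 i * e i) <=
    posterior X z phi g (om1 (ydraw X th phi e)) (ydraw X th phi e) gs.
  have [E01 Elow] := gexp_ge_expsum F01 lowF.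
  have /andP[_ E1] := E01; split => //.
  apply: le_trans Elow; rewrite lerB// !big_cat !big_map/=.
  under eq_bigr do rewrite vnsq nsqZ.
  under [X in _ + (X + _)]eq_bigr do rewrite vnsq nsqZ sqrrN.
  under [X in _ + (_ + X)]eq_bigr do rewrite vnsq nsqZ sqrrN.
  rewrite (coefsum (fun gam => expR ((h / (2 * Num.sqrt phi)) ^+ 2 * nsq (resid X th gam) / 2))).
  have usum : \sum_(u <- us) expR (- t ^+ 2) * expR (t ^+ 2 * nsq u / 2) <= D * expR (- (t ^+ 2 / 2)).
    have -> : D * expR (- (t ^+ 2 / 2)) = \sum_(u <- us) expR (- (t ^+ 2 / 2)).
      by rewrite big_const_seq count_predT szus iter_addr_0 /D mulr_natl.
    rewrite big_seq [leRHS]big_seq; apply: ler_sum => u /nus nu.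
    rewrite -expRD ler_expR; have : t ^+ 2 * nsq u <= t ^+ 2 by rewrite ler_piMr ?sqr_ge0.
    by lra.
  have m1 := ler_wpM2l (mulr_ge0 (ler0n _ 2) K0) (atten_mean pen1_ge0).
  have m2 := ler_wpM2l K0 (atten_mean pen2_ge0).
  by lra.
rewrite !big_cat !big_map/=.
set ev := \col_(i < n) e i.
under eq_bigr do rewrite vdot dotZl.
under [X in _ + (X + _)]eq_bigr do rewrite vdot dotZl.
under [X in _ + (_ + X)]eq_bigr do rewrite vdot dotZl.
rewrite (coefsum (linterm X th phi g ev)) -!/(attsum X th phi g ev _).
have a1 := mulr_ge0 K0 (attsum_ge0 ev pen1_ge0).
have a2 := mulr_ge0 K0 (attsum_ge0 ev pen2_ge0).
have /andP[F0 F1] := F01 e.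
have ex0 (r : R) : 0 <= \sum_(u <- us) expR (- t ^+ 2) * expR (r * dot u ev).
  by apply: sumr_ge0 => u _; rewrite mulr_ge0 ?expR_ge0.
have := ex0 t; have := ex0 (- t).
have [/hasP[u uus tu]|/hasPn small] := boolP (has (fun u => t < `|dot u ev|) us).
  move=> e1 e2.
  have big1 (r : R) : t ^+ 2 <= r * dot u ev ->
      1 <= \sum_(u <- us) expR (- t ^+ 2) * expR (r * dot u ev).
    move=> rt; rewrite (big_rem u)//= -[leLHS]addr0 lerD//.
      by rewrite -expRD -expR0 ler_expR; lra.
    by apply: sumr_ge0 => w _; rewrite mulr_ge0 ?expR_ge0.
  have : t ^+ 2 <= t * `|dot u ev| by rewrite expr2 ler_wpM2l// ltW.
  have [d0|d0] := lerP 0 (dot u ev).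
    by rewrite ger0_norm// => /big1; lra.
  by rewrite ltr0_norm// mulrN -mulNr => /big1; lra.
have taue : \sum_(u <- us) dot u ev ^+ 2 <= D * t ^+ 2.
  have -> : D * t ^+ 2 = \sum_(u <- us) t ^+ 2.
    by rewrite big_const_seq count_predT szus iter_addr_0 /D mulr_natl.
  rewrite big_seq [leRHS]big_seq; apply: ler_sum => u /small.
  by rewrite -leNgt -(real_normK (num_real (dot u ev))) => ?; rewrite ler_sqr ?nnegrE.
have st2 := step2_posterior usP taue.
rewrite -/K in st2.
have [half|half] := lerP (K * attsum X th phi g ev pen1) 2^-1; last by lra.
by have := st2 half; rewrite -ydE; lra.
Qed.

End TwoStep.

(** * Signal strength *)

Section Signal.
Variable R : realType.

Lemma le_sup_range (B : nat) (f : 'I_B -> R) (b : 'I_B) : f b <= sup (range f).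
Proof.
apply: ub_le_sup; last by exists b.
exists (\sum_i `|f i|) => _ [i _ <-]; apply: le_trans (ler_norm _) _.
by rewrite (bigD1 i)//= lerDl; exact: sumr_ge0.
Qed.

(** The common form of [1 - psi] and [1 - nu0]; [b] makes the range nonempty. *)
Lemma half_sup_range (B : nat) (f : 'I_B -> R) (b : 'I_B) :
  (forall i, 0 <= f i <= 1) -> 0 <= 1 - (1 + sup (range f)) / 2 <= 2^-1.
Proof.
move=> f01; have /andP[f0 _] := f01 b.
have sup0 : 0 <= sup (range f) by apply: le_trans (le_sup_range f b).
have sup1 : sup (range f) <= 1.
  apply: ge_sup; first by exists (f b); exists b.
  by move=> _ [i _ <-]; have /andP[] := f01 i.
by apply/andP; split; lra.
Qed.

Lemma ln_nat_ge0 (k : nat) : 0 <= ln (k%:R : R).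
Proof.
by case: k => [|k]; [rewrite ln0 | apply: ln_ge0; rewrite ler1n].
Qed.

Lemma half_ln (x : R) : 0 < x -> ln x / 2 = ln (Num.sqrt x).
Proof.
move=> x0; rewrite -{1}(sqr_sqrtr (ltW x0)) lnXn ?sqrtr_gt0//.
by rewrite -[X in X / 2]mulr_natr mulfK.
Qed.

(** In the main case [(P - q) s / q >= 1]. For [q = 0] division by 0 makes the argument -1, and for
    [q = P] it is 0; both logarithms are 0 by default. *)
Lemma ln_ratio_ge0 (P q s : nat) : (q <= s <= P)%N ->
  0 <= ln (P%:R / q%:R - 1 : R) + ln s%:R.
Proof.
move=> /andP[qs sP]; have := ln_nat_ge0 s.
have [->|q0] := posnP q; first by rewrite invr0 mulr0 sub0r (ln0 (lerN10 R)) add0r.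
have q0' : 0 < q%:R :> R by rewrite ltr0n.
have [->|Pq] := eqVneq P q; first by rewrite mulfV ?gt_eqF// subrr (ln0 (lexx 0)) add0r.
have s0 : 0 < s%:R :> R by rewrite ltr0n (leq_trans q0).
move=> _; have -> : P%:R / q%:R - 1 = (P - q)%:R / q%:R :> R.
  by rewrite natrB ?(leq_trans qs)// mulrBl mulfV// gt_eqF.
have Pq0 : 0 < (P - q)%:R :> R.
  by rewrite ltr0n subn_gt0 ltn_neqAle eq_sym Pq (leq_trans qs).
rewrite -lnM ?posrE ?divr_gt0//; apply: ln_ge0.
rewrite mulrAC ler_pdivlMr// mul1r -natrM ler_nat.
by rewrite (leq_trans qs)// leq_pmull// -(ltr0n R).
Qed.

(** A negative number has square root 0, so [w <= (sqrt w)^2] for every real [w], whatever the signs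
    of [x] and [y]. *)
Lemma sqr_sum_sqrt (x y a r : R) : 0 <= a -> r = Num.sqrt x + Num.sqrt y + a ->
  x + y <= r ^+ 2.
Proof.
move=> a0 ->; have sq (w : R) : w <= Num.sqrt w ^+ 2.
  have [w0|w0] := lerP 0 w; first by rewrite sqr_sqrtr.
  by rewrite ltr0_sqrtr// expr0n /= ltW.
have := sq x; have := sq y; have := sqrtr_ge0 x; have := sqrtr_ge0 y.
move: (Num.sqrt x) (Num.sqrt y) => u v v0 u0 yv xu.
have : 0 <= u * v by rewrite mulr_ge0.
have : 0 <= u * a by rewrite mulr_ge0.
have : 0 <= v * a by rewrite mulr_ge0.
by have := sqr_ge0 a; nra.
Qed.

(** Squaring gives [r^2 <= c A w^2 / 6], and [c <= 1/2] produces the 12. Positivity of [r] excludes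
    a nonpositive radicand, whose root would be 0. *)
Lemma signal_of_sqrt (c A w r : R) : 0 <= c <= 2^-1 -> 0 < r ->
  r <= Num.sqrt (c * A / 6) * `|w| -> 12 * r ^+ 2 <= A * w ^+ 2.
Proof.
move=> /andP[c0 c1] r0 rw.
have u0 : 0 < c * A / 6.
  rewrite ltNge; apply/negP => /ler0_sqrtr E.
  by move: rw; rewrite E mul0r leNgt r0.
have A0 : 0 < A.
  rewrite ltNge; apply/negP => A0.
  by have : c * A <= 0 := mulr_ge0_le0 c0 A0; lra.
have : r ^+ 2 <= (Num.sqrt (c * A / 6) * `|w|) ^+ 2.
  by rewrite ler_sqr ?nnegrE ?mulr_ge0 ?sqrtr_ge0// ltW.
rewrite exprMn sqr_sqrtr ?(ltW u0)// real_normK ?num_real// => rw2.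
have : 0 <= (2^-1 - c) * (A * w ^+ 2).
  by rewrite mulr_ge0 ?subr_ge0// mulr_ge0 ?sqr_ge0// ltW.
by nra.
Qed.

End Signal.

(** * Summing the attenuated penalties over blocks *)

Section BlockSums.
Variables (R : realType) (p B : nat) (z : 'I_p -> 'I_B).

Lemma sum_pgam (A : {set 'I_p}) : (\sum_(b < B) pgam z A b = #|A|)%N.
Proof.
rewrite -sum1_card (partition_big z predT)//=; apply: eq_bigr => b _.
by rewrite /pgam -sum1_card; apply: eq_bigl => j; rewrite inE.
Qed.

Lemma pblk_split (A : {set 'I_p}) b : (pblk z b = pgam z A b + pgam z (~: A) b)%N.
Proof.
have -> : pblk z b = #|[set j : 'I_p | z j == b]%SET|.
  by apply: eq_card => j; rewrite mem_block inE.
rewrite -(cardsID A); congr (_ + _)%N; apply: eq_card => j; rewrite !inE andbC//.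
Qed.

Lemma leq_pgamC (A A' : {set 'I_p}) b :
  A \subset A' -> (pgam z (~: A') b <= pgam z (~: A) b)%N.
Proof.
move=> /fintype.subsetP AA'; apply: subset_leq_card; apply/fintype.subsetP => j.
by rewrite !inE => /andP[jA ->]; rewrite andbT; apply: contra jA; exact: AA'.
Qed.

Lemma block_sum (s : 'I_B -> nat) (A : {set 'I_p}) (F : 'I_p -> R) (u v C : R) :
  0 <= u -> 0 <= v ->
  (forall b, 0 < s b)%N -> (forall b, pgam z A b <= s b)%N ->
  (forall b, (pgam z (~: A) b)%:R <= C) ->
  {in A, forall j, F j <= u / (s (z j))%:R} ->
  (forall j, j \notin A -> F j <= v) ->
  \sum_j F j <= B%:R * (u + C * v).
Proof.
move=> u0 v0 s0 As nAC FA FnA; rewrite (partition_big z predT)//=.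
apply: (@le_trans _ _ (\sum_(b < B) (u + C * v))); last first.
  by rewrite sumr_const card_ord -[leLHS]mulr_natl.
apply: ler_sum => b _; rewrite (bigID (mem A))/=; apply: lerD.
  apply: (@le_trans _ _ (\sum_(j in [set j in A | z j == b]%SET) u / (s b)%:R)).
    rewrite big_mkcond [leRHS]big_mkcond; apply: ler_sum => j _.
    rewrite inE andbC; case: (boolP (j \in A)) => //= jA; case: eqP => // <-.
    exact: FA.
  rewrite sumr_const -[leLHS]mulr_natl mulrCA ler_piMr//.
  by rewrite ler_pdivrMr ?ltr0n// mul1r ler_nat As.
apply: (@le_trans _ _ (\sum_(j in [set j in ~: A | z j == b]%SET) v)).
  rewrite big_mkcond [leRHS]big_mkcond; apply: ler_sum => j _.
  rewrite !inE andbC; case: (boolP (j \in A)) => //= jA; case: eqP => // _.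
  exact: FnA.
by rewrite sumr_const -[leLHS]mulr_natl ler_wpM2r// nAC.
Qed.

End BlockSums.

Section PenaltySums.
Variables (R : realType) (n p B : nat) (X : 'M[R]_(n, p)) (th : 'cV[R]_p).
Variables (z : 'I_p -> 'I_B) (phi g : R) (SL : 'I_B -> {set 'I_p}).
Hypothesis g0 : 0 < g.
Hypothesis s0 : forall b, (0 < sblk z th b)%N.
Hypothesis SLz : forall b j, j \in SL b -> z j = b /\ th j 0 != 0.
Let gs := gstar th.
Let G := Num.sqrt (1 + g * n%:R).
Let s b := sblk z th b.
Let A := [set j | j \in SL (z j)]%SET.
Variables (C eta : R).
Hypotheses (C0 : 0 <= C) (eta0 : 0 < eta) (eta1 : eta <= 2^-1).
Hypothesis CA : forall b, (pgam z (~: A) b)%:R <= C.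
Hypothesis small : (\sum_(b < B) s b)%:R <= eta ^+ 4 * G.
Hypothesis pG : p%:R <= G.
Hypothesis sig : {in gs, forall j, 12 * ln G <= signal X th phi j}.
Hypothesis sigL : {in A, forall j, 12 * (kappa0 n p g + ln (s (z j))%:R) <= signal X th phi j}.

Let A_gs : A \subset gs.
Proof. by apply/fintype.subsetP => j; rewrite !inE => /SLz[]. Qed.

Let sG b : (s b)%:R <= eta ^+ 4 * G.
Proof. by apply: le_trans small; rewrite ler_nat (bigD1 b)//= leq_addr. Qed.

Let gn1 : 1 <= 1 + g * n%:R.
Proof. by rewrite lerDl mulr_ge0// ltW. Qed.

Let G1 : 1 <= G.
Proof. by rewrite -[leLHS]sqrtr1 ler_wsqrtr. Qed.

Let G0 : 0 < G.
Proof. exact: lt_le_trans G1. Qed.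

Let Ginv (b : 'I_B) : G^-1 <= eta ^+ 4.
Proof.
rewrite -[leLHS]mul1r ler_pdivrMr//; apply: le_trans (sG b).
by rewrite ler1n s0.
Qed.

Let lnG : ln (1 + g * n%:R) / 2 = ln G.
Proof. by rewrite half_ln// (lt_le_trans _ gn1). Qed.

Let lnG0 : 0 <= ln G.
Proof. exact: ln_ge0. Qed.

Let shrinkE : shrink n g = 1 - (G^-1) ^+ 2.
Proof.
have gn0 : 0 < 1 + g * n%:R by exact: lt_le_trans gn1.
rewrite exprVn /G sqr_sqrtr ?ltW// /shrink; field.
by rewrite gt_eqF.
Qed.

(** The value 5/6 turns [12 ln G] into the attenuation exponent [(5/4) ln G]: one [G] to cancel
    penalties and [G^(1/4)] to spare. *)
Let shrink_big (b : 'I_B) : 5 / 6 <= shrink n g.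
Proof.
have e4 : eta ^+ 4 <= 2^-1 ^+ 4 by rewrite lerXn2r ?nnegrE ?invr_ge0// ltW.
have e2 : (2^-1 : R) ^+ 4 = 16^-1 by field.
have Gi : G^-1 <= 16^-1 by rewrite -e2; exact: le_trans (Ginv b) e4.
have Gi0 : 0 <= G^-1 by rewrite invr_ge0 ltW.
by rewrite shrinkE; have := ler_pM Gi0 Gi0 Gi Gi; rewrite expr2; lra.
Qed.

(** The spare factor [G^(-1/4)] is why smallness is stated with [eta ^+ 4]. The block [b] provides
    [1 <= s b], hence [1 / G <= eta ^+ 4]. *)
Let eta_quarter (b : 'I_B) : expR (- (ln G / 4)) <= eta.
Proof.
rewrite -(@ler_pXn2r _ 4) ?nnegrE ?expR_ge0 ?(ltW eta0)//.
rewrite -expRM_natl mulrN mulrC divfK// expRN lnK ?posrE//.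
exact: Ginv.
Qed.

Let attenG (j : 'I_p) : j \in gs ->
  expR (- (shrink n g / 8 * signal X th phi j)) <= expR (- (ln G / 4)) / G.
Proof.
have GE : expR (ln G) = G by rewrite lnK ?posrE.
move=> js; have -> : expR (- (ln G / 4)) / G = expR (- (ln G / 4) - ln G).
  by rewrite expRD (expRN (ln G)) GE.
rewrite ler_expR -opprD lerN2.
have := sig js; have := shrink_big (z j) => h5 sj.
have : 0 <= (shrink n g - 5 / 6) * signal X th phi j.
  by rewrite mulr_ge0 ?subr_ge0//; apply: le_trans sj; rewrite mulr_ge0.
by lra.
Qed.

Let inv_sqrt_pG (j : 'I_p) : (Num.sqrt (p%:R * G))^-1 <= eta.
Proof.
have p1 : 1 <= p%:R :> R by rewrite ler1n; case: j => k; case: (p).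
have pG0 : 0 < p%:R * G by rewrite mulr_gt0// (lt_le_trans ltr01).
rewrite -ler_sqr ?nnegrE ?invr_ge0 ?sqrtr_ge0 ?(ltW eta0)//.
rewrite exprVn sqr_sqrtr ?(ltW pG0)//.
apply: (@le_trans _ _ G^-1); first by rewrite lef_pV2 ?posrE// ler_peMl// ltW.
apply: le_trans (Ginv (z j)) _; rewrite ler_wiXn2l ?(ltW eta0)//.
by apply: le_trans eta1 _; lra.
Qed.

(** On [A] the attenuation is at most [1 / (p G s)], leaving [2 / (s sqrt (p G))]. Off [A] there are
    at most [C] covariates per block: active ones have [sqrt (p G) <= G] against [G^(-5/4)],
    inactive ones pay [2 / sqrt (p G)]. *)
Lemma pen1_sum :
  \sum_j pen1 n th g j * expR (- (shrink n g / 8 * signal X th phi j)) <=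
  B%:R * (2 * eta + C * (2 * eta)).
Proof.
have e20 : 0 <= 2 * eta by rewrite mulr_ge0// ltW.
apply: (@block_sum R p B z s A) => //.
- move=> b; rewrite subset_leq_card//; apply/fintype.subsetP => j.
  by rewrite !finset.in_set => /andP[/SLz[_ ->]] /=.
- move=> j jA; have js : j \in gs by exact: (fintype.subsetP A_gs).
  rewrite /pen1 -/gs js -/G.
  have p1 : 1 <= p%:R :> R by rewrite ler1n; case: (j) => k; case: (p).
  have p0 : 0 < p%:R :> R by exact: lt_le_trans p1.
  have sp : 0 < (s (z j))%:R :> R by rewrite ltr0n s0.
  have key : expR (- (shrink n g / 8 * signal X th phi j)) <= (p%:R * G * (s (z j))%:R)^-1.
    have E : p%:R * G * (s (z j))%:R = expR (kappa0 n p g + ln (s (z j))%:R).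
      by rewrite /kappa0 lnG !expRD !lnK.
    rewrite E -expRN ler_expR lerN2.
    have k0 : 0 <= kappa0 n p g + ln (s (z j))%:R.
      by rewrite /kappa0 lnG !addr_ge0 ?ln_nat_ge0.
    have := sigL jA; have := shrink_big (z j) => h5 sj.
    have : 0 <= (shrink n g - 5 / 6) * signal X th phi j.
      by rewrite mulr_ge0 ?subr_ge0//; apply: le_trans sj; rewrite mulr_ge0.
    by lra.
  have q0 : 0 < Num.sqrt (p%:R * G) by rewrite sqrtr_gt0 mulr_gt0.
  have := ler_wpM2l (mulr_ge0 (ler0n R 2) (ltW q0)) key => /le_trans; apply.
  rewrite invfM mulrA ler_pM2r ?invr_gt0// -mulrA ler_pM2l//.
  apply: le_trans (inv_sqrt_pG j).
  by rewrite -{2}(@sqr_sqrtr _ (p%:R * G) (ltW (mulr_gt0 p0 G0))) expr2 invfM mulVKf// gt_eqF.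
- move=> j jA; rewrite /pen1 -/gs -/G; case: ifPn => js; last first.
    have -> : signal X th phi j = 0.
      by rewrite /signal; move: js; rewrite inE negbK => /eqP ->; rewrite expr0n mulr0 mul0r.
    by rewrite mulr0 oppr0 expR0 mulr1 ler_pM2l// inv_sqrt_pG.
  rewrite -[leLHS]mulrA ler_pM2l//.
  apply: (@le_trans _ _ (G * (expR (- (ln G / 4)) / G))).
    apply: ler_pM; rewrite ?sqrtr_ge0 ?expR_ge0//; last exact: attenG.
    rewrite -[leRHS]gtr0_norm// -sqrtr_sqr ler_wsqrtr// expr2 ler_pM2r//.
  by rewrite mulrC divfK ?gt_eqF// (eta_quarter (z j)).
Qed.

(** Here the split is at [gs]: for active covariates [s <= G] gives [sqrt (G / s) <= G / s], and
    [attenG] cancels this [G]; each inactive one pays [sqrt (3 s / G) <= 2 eta]. *)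
Lemma pen2_sum :
  \sum_j pen2 n th z g j * expR (- (shrink n g / 8 * signal X th phi j)) <=
  B%:R * (Num.sqrt (2 * (C + 1)) * eta + C * (2 * eta)).
Proof.
have e20 : 0 <= 2 * eta by rewrite mulr_ge0// ltW.
have gsC b : (pgam z (~: gs) b)%:R <= C.
  by apply: le_trans (CA b); rewrite ler_nat leq_pgamC.
have dC b : (pblk z b - sblk z th b)%:R <= C.
  by rewrite (pblk_split z gs) /sblk addKn.
apply: (@block_sum R p B z s gs) => //.
- by rewrite mulr_ge0 ?sqrtr_ge0// ltW.
- move=> j js; rewrite /pen2 -/gs js -/G -/s.
  have sp : 0 < (s (z j))%:R :> R by rewrite ltr0n s0.
  have sGj : (s (z j))%:R <= G.
    apply: le_trans (sG (z j)) _; rewrite ler_piMl ?(ltW G0)//.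
    by rewrite exprn_ile1 ?(ltW eta0)//; apply: le_trans eta1 _; lra.
  have key : Num.sqrt (2 * ((pblk z (z j) - s (z j))%:R + 1) * G / (s (z j))%:R) <=
      Num.sqrt (2 * (C + 1)) * (G / (s (z j))%:R).
    rewrite -[G / _ in leRHS]ger0_norm ?divr_ge0 ?(ltW G0)// -sqrtr_sqr -sqrtrM; last by rewrite mulr_ge0// addr_ge0.
    apply: ler_wsqrtr; rewrite -[leLHS]mulrA.
    apply: ler_pM; rewrite ?mulr_ge0 ?addr_ge0 ?divr_ge0 ?(ltW G0)//.
      by rewrite ler_pM2l// lerD2r dC.
    by rewrite expr2 ler_peMl ?divr_ge0 ?(ltW G0)// ler_pdivlMr// mul1r.
  apply: le_trans (ler_pM (sqrtr_ge0 _) (expR_ge0 _) key (attenG js)) _.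
  have -> : Num.sqrt (2 * (C + 1)) * (G / (s (z j))%:R) * (expR (- (ln G / 4)) / G) =
    Num.sqrt (2 * (C + 1)) * expR (- (ln G / 4)) / (s (z j))%:R.
    by field; rewrite !gt_eqF.
  by rewrite ler_pM2r ?invr_gt0// ler_wpM2l ?sqrtr_ge0// (eta_quarter (z j)).
- move=> j js; rewrite /pen2 -/gs (negPf js) -/G -/s.
  have -> : signal X th phi j = 0.
    by rewrite /signal; move: js; rewrite inE negbK => /eqP ->; rewrite expr0n mulr0 mul0r.
  rewrite mulr0 oppr0 expR0 mulr1.
  rewrite -[leRHS]ger0_norm// -sqrtr_sqr ler_wsqrtr// -mulrA.
  have sGe : (s (z j))%:R / G <= eta ^+ 4 by rewrite ler_pdivrMr// sG.
  have : eta ^+ 4 <= eta ^+ 2.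
    by rewrite ler_wiXn2l ?(ltW eta0)//; apply: le_trans eta1 _; lra.
  by rewrite exprMn; have := sqr_ge0 eta; lra.
Qed.

End PenaltySums.

(** * From the signal and sparsity assumptions to a bound at one sample size *)

Section FixedSampleSize.
Variables (R : realType) (n p B : nat) (X : 'M[R]_(n, p)) (th : 'cV[R]_p).
Variables (z : 'I_p -> 'I_B) (phi g : R) (SL : 'I_B -> {set 'I_p}).
Hypotheses (phi0 : 0 < phi) (g0 : 0 < g).
Hypothesis s0 : forall b, (0 < sblk z th b)%N.
Hypothesis SLz : forall b j, j \in SL b -> z j = b /\ th j 0 != 0.
Let gs := gstar th.
Let G := Num.sqrt (1 + g * n%:R).

Let gn1 : 1 <= 1 + g * n%:R.
Proof. by rewrite lerDl mulr_ge0// ltW. Qed.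

Let G1 : 1 <= G.
Proof. by rewrite -[leLHS]sqrtr1 ler_wsqrtr. Qed.

Let G0 : 0 < G.
Proof. exact: lt_le_trans G1. Qed.

Let lnG : ln (1 + g * n%:R) / 2 = ln G.
Proof. by rewrite half_ln// (lt_le_trans _ gn1). Qed.

Let sblk_le b : (sblk z th b <= pblk z b)%N.
Proof. by rewrite (pblk_split z gs) leq_addr. Qed.

(** The denominator in [psi] is [ln (p_b - s_b) + ln (G / s_b)], at least the numerator when
    [s_b <= G]. If [p_b = s_b] the ratio is 0, since [ln 0 = 0]. *)
Lemma one_sub_psi (b : 'I_B) : (forall i, (sblk z th i)%:R <= G) ->
  0 <= 1 - psi n z th g <= 2^-1.
Proof.
move=> sG; apply: half_sup_range b _ => i.
have sp : 0 < (sblk z th i)%:R :> R by rewrite ltr0n.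
have [d0|d0] := posnP (pblk z i - sblk z th i)%N.
  by rewrite d0 (ln0 (lexx 0)) mul0r lexx ler01.
have dp : 0 < (pblk z i - sblk z th i)%:R :> R by rewrite ltr0n.
have -> : (pblk z i)%:R / (sblk z th i)%:R - 1 =
    (pblk z i - sblk z th i)%:R / (sblk z th i)%:R :> R.
  by rewrite natrB// mulrBl mulfV// gt_eqF.
rewrite lnG; have l0 := ln_nat_ge0 R (pblk z i - sblk z th i).
have -> : ln ((pblk z i - sblk z th i)%:R / (sblk z th i)%:R) + ln G =
    ln (pblk z i - sblk z th i)%:R + ln (G / (sblk z th i)%:R).
  by rewrite !ln_div ?posrE//; ring.
have q0 : 0 <= ln (G / (sblk z th i)%:R).
  by apply: ln_ge0; rewrite ler_pdivlMr// mul1r.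
rewrite divr_ge0 ?addr_ge0//=.
have [E|N] := eqVneq (ln (pblk z i - sblk z th i)%:R + ln (G / (sblk z th i)%:R)) 0.
  by rewrite E invr0 mulr0 ler01.
by rewrite ler_pdivrMr ?mul1r ?lerDl// lt_neqAle eq_sym N addr_ge0.
Qed.

Lemma one_sub_nu0 (b : 'I_B) : 0 <= 1 - nu0 n z th g <= 2^-1.
Proof.
apply: half_sup_range b _ => i; have l0 := ln_nat_ge0 R (pblk z i - sblk z th i).
have k0 : 0 <= kappa0 n p g.
  by rewrite /kappa0 lnG addr_ge0 ?ln_nat_ge0// ln_ge0.
rewrite divr_ge0//=; have [->|N] := eqVneq (kappa0 n p g) 0.
  by rewrite invr0 mulr0 ler01.
rewrite ler_pdivrMr ?mul1r; last by rewrite lt_neqAle eq_sym N.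
rewrite /kappa0 lnG; apply: ler_wpDr; first exact: ln_ge0.
have [->|d0] := posnP (pblk z i - sblk z th i)%N; first by rewrite (ln0 (lexx 0)) ln_nat_ge0.
have dp : (pblk z i - sblk z th i <= p)%N.
  by rewrite (leq_trans (leq_subr _ _))// -[leqRHS](card_ord p) max_card.
by rewrite ler_ln ?posrE ?ltr0n ?ler_nat// (leq_trans d0).
Qed.

Lemma theta_min_le j : th j 0 != 0 -> theta_min z th (z j) <= `|th j 0|.
Proof.
by move=> j0; apply: ge_inf; [exists 0 => _ [i [_ [_ ->]]] | exists j].
Qed.

Let signalE j : signal X th phi j = n%:R * rhoX X gs / phi * th j 0 ^+ 2.
Proof. by rewrite /signal mulrAC. Qed.

(** Squaring the equation bounds the signal by 12 times the sum of the radicands; by [ln_ratio_ge0]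
    the terms other than [ln G] add up to something nonnegative. *)
Lemma signal_active (a : R) j : (forall i, (sblk z th i)%:R <= G) -> 0 < a -> j \in gs ->
  Num.sqrt ((1 - psi n z th g) * n%:R / phi * rhoX X gs / 6) * theta_min z th (z j)
  - Num.sqrt (ln ((pblk z (z j))%:R / #|SL (z j)|%:R - 1) + ln (1 + g * n%:R) / 2)
  = Num.sqrt (ln (sblk z th (z j))%:R) + a ->
  12 * ln G <= signal X th phi j.
Proof.
move=> sG a0 js /eqP; rewrite subr_eq => /eqP E.
set x := ln (_ - 1) + _ in E; set y := ln (sblk z th (z j))%:R in E.
pose r := Num.sqrt x + Num.sqrt y + a.
have r0 : 0 < r by rewrite ltr_pwDr// addr_ge0 ?sqrtr_ge0.
have rE : r = Num.sqrt x + Num.sqrt y + a by [].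
have rsq := sqr_sum_sqrt (ltW a0) rE.
rewrite signalE; apply: (@le_trans _ _ (12 * r ^+ 2)).
  rewrite ler_pM2l//; apply: le_trans rsq.
  have : 0 <= ln ((pblk z (z j))%:R / #|SL (z j)|%:R - 1 : R) + y.
    apply: ln_ratio_ge0; rewrite sblk_le andbT; apply: subset_leq_card.
    by apply/fintype.subsetP => i /SLz[iz i0]; rewrite finset.in_set iz eqxx inE i0.
  by rewrite /x lnG; lra.
apply: (signal_of_sqrt (one_sub_psi (z j) sG)) => //.
have -> : (1 - psi n z th g) * (n%:R * rhoX X gs / phi) / 6 =
    (1 - psi n z th g) * n%:R / phi * rhoX X gs / 6 by field; rewrite gt_eqF.
have -> : r = Num.sqrt ((1 - psi n z th g) * n%:R / phi * rhoX X gs / 6) * theta_min z th (z j).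
  by rewrite E /r; ring.
rewrite ler_wpM2l ?sqrtr_ge0//; apply: theta_min_le.
by move: js; rewrite inE.
Qed.

Lemma signal_large j :
  1 <= Num.sqrt ((1 - nu0 n z th g) * n%:R * rhoX X gs / (6 * phi)) * `|th j 0|
       - Num.sqrt (kappa0 n p g) - Num.sqrt (ln (sblk z th (z j))%:R) ->
  12 * (kappa0 n p g + ln (sblk z th (z j))%:R) <= signal X th phi j.
Proof.
move=> H; set x := kappa0 n p g; set y := ln _.
pose r := Num.sqrt x + Num.sqrt y + 1.
have r0 : 0 < r by rewrite ltr_pwDr// addr_ge0 ?sqrtr_ge0.
have rsq := @sqr_sum_sqrt R x y 1 r ler01 erefl.
rewrite signalE; apply: (@le_trans _ _ (12 * r ^+ 2)); first by rewrite ler_pM2l.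
apply: (signal_of_sqrt (one_sub_nu0 (z j))) => //.
have -> : (1 - nu0 n z th g) * (n%:R * rhoX X gs / phi) / 6 =
    (1 - nu0 n z th g) * n%:R * rhoX X gs / (6 * phi) by field; rewrite gt_eqF.
by move: H; rewrite -/x -/y /r; lra.
Qed.

Lemma two_step_near_one (C eta t : R) :
  (0 < n)%N -> fullrank X gs -> 0 <= C -> 0 < eta -> eta <= 2^-1 -> 0 <= t ->
  (forall b, (pgam z (~: [set j | j \in SL (z j)]%SET) b)%:R <= C) ->
  (\sum_(b < B) sblk z th b)%:R <= eta ^+ 4 * G ->
  eta ^+ 4 * (1 + B%:R * C) <= 1 ->
  ((forall i, (sblk z th i)%:R <= G) -> {in gs, forall j, 12 * ln G <= signal X th phi j}) ->
  (forall b j, j \in SL b ->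
     1 <= Num.sqrt ((1 - nu0 n z th g) * n%:R * rhoX X gs / (6 * phi)) * `|th j 0|
          - Num.sqrt (kappa0 n p g) - Num.sqrt (ln (sblk z th b)%:R)) ->
  let E := gexp n (fun e => posterior X z phi g
      (omega1 X z phi g (ydraw X th phi e)) (ydraw X th phi e) gs) in
  let K := expR (B%:R * C * t ^+ 2 / 4) in
  E <= 1 /\
  1 - (2 * (B%:R * C) * expR (- (t ^+ 2 / 2)) +
       2 * K * (expR (B%:R * (2 * eta + C * (2 * eta))) - 1) +
       K * (expR (B%:R * (Num.sqrt (2 * (C + 1)) * eta + C * (2 * eta))) - 1)) <= E.
Proof.
move=> n0 frs C0 eta0 eta1 t0 CA small etaC sigA sigL0 E K.
set A := [set j | j \in SL (z j)]%SET in CA.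
have A_gs : A \subset gs by apply/fintype.subsetP => j; rewrite !inE => /SLz[].
have gsC b : (pgam z (~: gs) b)%:R <= C.
  by apply: le_trans (CA b); rewrite ler_nat leq_pgamC.
have DC : #|~: gs|%:R <= B%:R * C.
  rewrite -(sum_pgam z) natr_sum.
  apply: (@le_trans _ _ (\sum_(b < B) C)); first exact: ler_sum.
  by rewrite sumr_const card_ord -[leLHS]mulr_natl.
have eta4 : eta ^+ 4 <= 1 by rewrite exprn_ile1 ?(ltW eta0)//; apply: le_trans eta1 _; lra.
have sG b : (sblk z th b)%:R <= G.
  apply: (@le_trans _ _ (eta ^+ 4 * G)); last by rewrite ler_piMl// ltW.
  by apply: le_trans small; rewrite ler_nat (bigD1 b)//= leq_addr.
(* With [S >= 1] the total number of signals, [p <= S + B C <= S (1 + B C) <= eta^4 G (1 + B C) <=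
   G]. *)
have pG : p%:R <= G.
  have [p0|p0] := posnP p; first by rewrite p0 ltW.
  have b := z (Ordinal p0).
  have S1 : 1 <= (\sum_(b < B) sblk z th b)%:R :> R.
    by rewrite ler1n (bigD1 b)//= ltn_addr.
  have -> : p = (\sum_(b < B) sblk z th b + #|~: gs|)%N.
    by rewrite sum_pgam cardsC card_ord.
  rewrite natrD; move: (_%:R) S1 small => S S1 small.
  have BC0 : 0 <= B%:R * C by rewrite mulr_ge0.
  have h1 : 0 <= (S - 1) * (B%:R * C) by rewrite mulr_ge0// subr_ge0.
  have h2 := ler_wpM2r (addr_ge0 ler01 BC0) small.
  have h3 := ler_wpM2r (ltW G0) etaC.
  by lra.
have sigL : {in A, forall j, 12 * (kappa0 n p g + ln (sblk z th (z j))%:R) <= signal X th phi j}.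
  by move=> j; rewrite inE => jA; apply: signal_large; exact: sigL0 jA.
have P1 := pen1_sum g0 s0 SLz eta0 eta1 CA small pG (sigA sG) sigL.
have P2 := pen2_sum g0 s0 SLz C0 eta0 eta1 CA small (sigA sG).
have [E1 Elow] := two_step_bound n0 phi0 g0 frs s0 t0.
split => //; apply: le_trans Elow; rewrite lerB//.
have D0 : 0 <= #|~: gs|%:R :> R by [].
have KK : expR (#|~: gs|%:R * t ^+ 2 / 4) <= K.
  by rewrite ler_expR ler_pM2r// ler_wpM2r ?sqr_ge0.
have pen1p : 0 <= \sum_j pen1 n th g j * expR (- (shrink n g / 8 * signal X th phi j)).
  apply: sumr_ge0 => j _; rewrite mulr_ge0 ?expR_ge0// /pen1.
  by case: ifP => _; rewrite mulr_ge0 ?invr_ge0 ?sqrtr_ge0.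
have pen2p : 0 <= \sum_j pen2 n th z g j * expR (- (shrink n g / 8 * signal X th phi j)).
  apply: sumr_ge0 => j _; rewrite mulr_ge0 ?expR_ge0// /pen2.
  by case: ifP => _; rewrite sqrtr_ge0.
have em1 (u : R) : 0 <= u -> 0 <= expR u - 1.
  by move=> u0; rewrite subr_ge0 -[leLHS]expR0 ler_expR.
apply: lerD; first apply: lerD.
- by rewrite ler_wpM2r ?expR_ge0// ler_pM2l.
- apply: ler_pM; [by rewrite mulr_ge0 ?expR_ge0 | exact: em1 | by rewrite ler_pM2l |].
  by rewrite lerB// ler_expR.
- apply: ler_pM; [exact: expR_ge0 | exact: em1 | exact: KK |].
  by rewrite lerB// ler_expR.
Qed.

End FixedSampleSize.

(** * Passage to the limit *)

Lemma expR_sub1_le (R : realType) (u : R) : 0 <= u <= 2^-1 -> expR u - 1 <= 2 * u.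
Proof.
move=> /andP[u0 u1]; have := expR_ge1Dx (- u); rewrite expRN => h.
have e0 := expR_gt0 u; have := ler_wpM2r (ltW e0) h; rewrite mulVf ?gt_eqF// => h1.
have : 0 <= u * (1 - 2 * u) by rewrite mulr_ge0//; lra.
by nra.
Qed.

(** Asymptotic conditions do not determine a set at a fixed [n], so the signal sets enter as
    families [SS] and [SL] whose members satisfy them uniformly within each block. *)
Theorem theorem2 (R : realType) (B : nat) (p : nat -> nat)
  (X : forall n, 'M[R]_(n, p n)) (theta : forall n, 'cV[R]_(p n))
  (z : forall n, 'I_(p n) -> 'I_B) (phi g : nat -> R)
  (SS SL : forall n, 'I_B -> {set 'I_(p n)}) :
  (* standing assumptions *)
  (forall n, 0 < phi n) ->
  (forall n, 0 < g n) ->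
  (forall n, fullrank (X n) (gstar (theta n))) ->
  (* SS n b is a set of small signals S^S_b(kappa^(0)) *)
  (forall n b j, j \in SS n b -> z n j = b /\ theta n j 0 != 0) ->
  (forall (b : 'I_B) (eps : R), 0 < eps -> \forall n \near \oo,
     forall j, j \in SS n b ->
       Num.sqrt (n%:R * lambda_bar (X n) (gstar (theta n))) * `|theta n j 0|
         / Num.sqrt (phi n)
       <= eps * Num.sqrt (kappa0 n (p n) (g n))) ->
  (* SL n b is a set of large signals S^L_b(kappa^(0)) *)
  (forall n b j, j \in SL n b -> z n j = b /\ theta n j 0 != 0) ->
  (forall (b : 'I_B) (M : R), \forall n \near \oo,
     forall j, j \in SL n b ->
       M <= Num.sqrt ((1 - nu0 n (z n) (theta n) (g n)) * n%:R
                        * rhoX (X n) (gstar (theta n)) / (6 * phi n)) * `|theta n j 0|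
            - Num.sqrt (kappa0 n (p n) (g n))
            - Num.sqrt (ln (sblk (z n) (theta n) b)%:R)) ->
  (* (A4) *)
  ((fun n => (\sum_(b < B) sblk (z n) (theta n) b)%:R / Num.sqrt (1 + g n * n%:R))
     @ \oo --> (0 : R)) ->
  (* (A5) *)
  (forall b : 'I_B, exists a : nat -> R, (a n @[n --> \oo] --> +oo) /\
     \forall n \near \oo,
       Num.sqrt ((1 - psi n (z n) (theta n) (g n)) * n%:R / phi n
                   * rhoX (X n) (gstar (theta n)) / 6) * theta_min (z n) (theta n) b
       - Num.sqrt (ln ((pblk (z n) b)%:R / #|SL n b|%:R - 1) + ln (1 + g n * n%:R) / 2)
       = Num.sqrt (ln (sblk (z n) (theta n) b)%:R) + a n) ->
  (* (A6) *)
  (forall b : 'I_B,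
     (exists C : R, \forall n \near \oo, #|SIset (z n) (SS n b) (SL n b) b|%:R <= C) /\
     (exists C : R, \forall n \near \oo,
        #|SS n b|%:R <= C * (pblk (z n) b - sblk (z n) (theta n) b)%:R)) ->
  (* conclusion: E[ pi(gamma* | y, omega_hat^(1)(y)) ] -> 1 *)
  (fun n => gexp n (fun e =>
      let y := ydraw (X n) (theta n) (phi n) e in
      posterior (X n) (z n) (phi n) (g n)
                (omega1 (X n) (z n) (phi n) (g n) y) y (gstar (theta n))))
    @ \oo --> (1 : R).
Proof.
move=> phi0 g0 frs SSz _ SLz SLbig A4 A5 A6.
pose A n := [set j | j \in SL n (z n j)]%SET.
have [C C0 CA] : exists2 C : R, 0 <= C &
    \forall n \near \oo, forall b, (pgam (z n) (~: A n) b)%:R <= C.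
  have cb (b : 'I_B) : exists c : R, \forall n \near \oo, (pgam (z n) (~: A n) b)%:R <= c.
    (* Inactive covariates lie in the intermediate set, so [p_b - s_b <= c1], and then the small set
       has at most [|c2| c1] elements. *)
    have [[c1 H1] [c2 H2]] := A6 b; exists (c1 + `|c2| * c1); near=> n.
    have h1 : #|SIset (z n) (SS n b) (SL n b) b|%:R <= c1 by near: n.
    have h2 : #|SS n b|%:R <= c2 * (pblk (z n) b - sblk (z n) (theta n) b)%:R by near: n.
    have inact : (pblk (z n) b - sblk (z n) (theta n) b <= #|SIset (z n) (SS n b) (SL n b) b|)%N.
      rewrite (pblk_split _ (gstar (theta n))) /sblk addKn; apply: subset_leq_card.
      apply/fintype.subsetP => j; rewrite /SIset !inE negbK => /andP[/eqP j0 ->].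
      rewrite andbT negb_or; apply/andP; split.
        by apply/negP => /SLz[_]; rewrite j0 eqxx.
      by apply/negP => /SSz[_]; rewrite j0 eqxx.
    have sub : (pgam (z n) (~: A n) b <= #|SIset (z n) (SS n b) (SL n b) b| + #|SS n b|)%N.
      apply: leq_trans (leq_card_setU _ _); apply: subset_leq_card.
      apply/fintype.subsetP => j; rewrite /SIset !inE => /andP[jA /eqP jb].
      rewrite jb in jA; rewrite jb eqxx andbT negb_or jA /=.
      by case: (j \in SS n b).
    have d1 : (pblk (z n) b - sblk (z n) (theta n) b)%:R <= c1.
      by apply: le_trans h1; rewrite ler_nat.
    apply: (@le_trans _ _ (#|SIset (z n) (SS n b) (SL n b) b| + #|SS n b|)%:R).
      by rewrite ler_nat.
    rewrite natrD lerD//; apply: le_trans h2 _.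
    apply: (@le_trans _ _ (`|c2| * (pblk (z n) b - sblk (z n) (theta n) b)%:R)).
      by rewrite ler_wpM2r// ler_norm.
    by rewrite ler_wpM2l.
  have [c Hc] := choice cb.
  exists (\sum_b `|c b|); first exact: sumr_ge0.
  apply: filterS (filter_forall _ Hc) => n Hn b; apply: le_trans (Hn b) _.
  by apply: le_trans (ler_norm _) _; rewrite (bigD1 b)//= lerDl sumr_ge0.
have [a Ha] := choice A5.
apply/cvgrPdist_le => eps eps0.
pose e := Num.min eps 1.
have e0 : 0 < e by rewrite lt_min eps0 ltr01.
have e1 : e <= 1 by rewrite ge_min lexx orbT.
pose BC := B%:R * C; have BC0 : 0 <= BC by rewrite mulr_ge0.
(* Chosen so that the tail [2 BC exp (- x)] is at most [2 BC / (1 + x) <= e / 3]. *)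
pose x := 6 * BC / e; have x0 : 0 <= x by rewrite divr_ge0 ?(ltW e0)// mulr_ge0.
pose t := Num.sqrt (2 * x); have t0 : 0 <= t by rewrite sqrtr_ge0.
have tx : t ^+ 2 / 2 = x by rewrite /t (sqr_sqrtr (mulr_ge0 (ler0n R 2) x0)) mulrC mulKf.
pose K := expR (BC * t ^+ 2 / 4).
have K1 : 1 <= K by rewrite -expR0 ler_expR !mulr_ge0 ?sqr_ge0.
pose M1 := B%:R * (2 + C * 2); pose M2 := B%:R * (Num.sqrt (2 * (C + 1)) + C * 2).
have M10 : 0 <= M1 by rewrite mulr_ge0// addr_ge0// mulr_ge0.
have M20 : 0 <= M2 by rewrite mulr_ge0// addr_ge0 ?sqrtr_ge0// mulr_ge0.
(* [M1] and [M2] are the coefficients of [eta] in the two exponents, and [1 + BC] serves [etaC]. As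
   [K] depends on [t] alone, [eta] can then be chosen with [K M eta = e / 12], so the two remaining
   terms total at most [e / 3]. *)
pose M := M1 + M2 + (1 + BC).
have Mge1 : 1 <= M by rewrite /M; lra.
have KM0 : 0 < 12 * K * M by rewrite !mulr_gt0//; lra.
pose eta := e / (12 * K * M).
have eta0 : 0 < eta by rewrite divr_gt0.
have KMeta : K * M * eta = e / 12 by rewrite /eta; field; rewrite !gt_eqF//; lra.
have Meta : M * eta <= e / 12.
  rewrite -KMeta -mulrA; apply: ler_peMl => //; rewrite mulr_ge0 ?(ltW eta0)//; lra.
have eta12 : eta <= e / 12.
  by apply: le_trans Meta; apply: ler_peMl => //; exact: ltW.
have eta1 : eta <= 2^-1 by lra.
have etaC : eta ^+ 4 * (1 + B%:R * C) <= 1.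
  have h4 : eta ^+ 4 <= eta by rewrite -[leRHS]expr1 ler_wiXn2l ?(ltW eta0)//; lra.
  have h5 := ler_wpM2r (addr_ge0 ler01 BC0) h4.
  have h6 : 0 <= eta * (M1 + M2) by rewrite mulr_ge0 ?addr_ge0// ltW.
  by rewrite -/BC; rewrite /M in Meta; lra.
have A4' : \forall n \near \oo, (\sum_(b < B) sblk (z n) (theta n) b)%:R <=
    eta ^+ 4 * Num.sqrt (1 + g n * n%:R).
  have /cvgrPdist_le/(_ (eta ^+ 4)) := A4; rewrite exprn_gt0// => /(_ isT).
  apply: filterS => n; rewrite sub0r normrN ger0_norm ?divr_ge0 ?sqrtr_ge0//.
  rewrite ler_pdivrMr// sqrtr_gt0 ltr_pwDl// mulr_ge0// ltW//.
have apos : \forall n \near \oo, forall b, 0 < a b n.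
  apply: filter_forall => b; have [/cvgryPgt/(_ 0) H _] := Ha b; exact: H.
have aeq := filter_forall _ (fun b => proj2 (Ha b)).
have SLb := filter_forall _ (fun b => SLbig b 1).
near=> n.
have n0 : (0 < n)%N by near: n; exact: nbhs_infty_gt.
have an0 : forall b, 0 < a b n by near: n.
have an : forall b, Num.sqrt ((1 - psi n (z n) (theta n) (g n)) * n%:R / phi n
                   * rhoX (X n) (gstar (theta n)) / 6) * theta_min (z n) (theta n) b
       - Num.sqrt (ln ((pblk (z n) b)%:R / #|SL n b|%:R - 1) + ln (1 + g n * n%:R) / 2)
       = Num.sqrt (ln (sblk (z n) (theta n) b)%:R) + a b n by near: n; exact: aeq.
(* In a block without signals [theta_min] is the infimum of the empty set, 0, so the left side of
   (A5) would be at most 0 and the right side positive. *)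
have s0 b : (0 < sblk (z n) (theta n) b)%N.
  rewrite lt0n; apply/negP => /eqP sb0; have := an b.
  have -> : theta_min (z n) (theta n) b = 0.
    rewrite /theta_min (_ : [set r | _] = set0) ?inf0//.
    apply/seteqP; split => // r [j [jb [j0 _]]]; move: sb0; apply/eqP.
    rewrite -lt0n card_gt0; apply/finset.set0Pn; exists j.
    by rewrite finset.in_set jb eqxx inE j0.
  have := an0 b; have := sqrtr_ge0 (ln (sblk (z n) (theta n) b)%:R : R).
  have := sqrtr_ge0 (ln ((pblk (z n) b)%:R / #|SL n b|%:R - 1) + ln (1 + g n * n%:R) / 2).
  by rewrite mulr0; lra.
have [|||||E1 Elow] := @two_step_near_one R n (p n) B (X n) (theta n) (z n) (phi n) (g n)
  (SL n) (phi0 n) (g0 n) s0 (SLz n) C eta t n0 (frs n) C0 eta0 eta1 t0.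
- by near: n; exact: CA.
- by near: n; exact: A4'.
- exact: etaC.
- move=> sG j js; apply: (signal_active (phi0 n) (g0 n) s0 (SLz n) sG (an0 (z n j)) js).
  exact: an.
- by near: n; exact: SLb.
rewrite -/K -/BC in Elow.
set Ex := gexp n _ in E1 Elow; rewrite ger0_norm ?subr_ge0//.
apply: (@le_trans _ _ e); last by rewrite ge_min lexx.
rewrite lerBlDl -lerBlDr; apply: le_trans Elow; rewrite lerB//.
have -> : B%:R * (2 * eta + C * (2 * eta)) = M1 * eta by rewrite /M1; ring.
have -> : B%:R * (Num.sqrt (2 * (C + 1)) * eta + C * (2 * eta)) = M2 * eta by rewrite /M2; ring.
have M1e : 0 <= M1 * eta by rewrite mulr_ge0// ltW.
have M2e : 0 <= M2 * eta by rewrite mulr_ge0// ltW.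
have BCe : 0 <= (1 + BC) * eta by rewrite mulr_ge0 ?addr_ge0// ltW.
have Msum : M1 * eta + M2 * eta <= M * eta by rewrite /M !mulrDl; rewrite mulrDl in BCe; lra.
have X1 : expR (M1 * eta) - 1 <= 2 * (M1 * eta) by apply: expR_sub1_le; rewrite M1e; lra.
have X2 : expR (M2 * eta) - 1 <= 2 * (M2 * eta) by apply: expR_sub1_le; rewrite M2e; lra.
have K0 : 0 <= K by lra.
have Y1 := ler_wpM2l K0 X1; have Y2 := ler_wpM2l K0 X2; have Y3 := ler_wpM2l K0 Msum.
have Y4 : 0 <= K * (M2 * eta) by rewrite mulr_ge0.
have tail : 2 * BC * expR (- (t ^+ 2 / 2)) <= e / 3.
  rewrite tx expRN ler_pdivrMr ?expR_gt0//.
  have := ler_wpM2l (ltW e0) (expR_ge1Dx x); rewrite mulrDr mulr1 /x mulrC divfK ?gt_eqF//.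
  by lra.
have KMe : K * (M * eta) = e / 12 by rewrite mulrA.
by lra.
Unshelve. all: by end_near.
Qed.
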